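(* Let $G=(V,q)$ be a reversible connected graph with non-negative Ollivier curvature, let $\widetilde G=(V\times V,\widetilde q)$ be a perfect coupling graph of $G$ with heat semigroup $\widetilde P_t$, and let $W:=V^2\setminus\{(x,x):x\in V\}$. Then for all $t>0$ and $x,y\in V$, \[ \widetilde P_t1_W(x,y)\le\phi_t(d(x,y))\le\frac{d(x,y)}{2\sqrt{t\,q_{\min}}}. \]
   Context: A graph $G=(V,q)$ consists of a countable set $V$ and a function $q:V\times V\to[0,\infty)$ such that $\#\{y:q(x,y)>0\}<\infty$ for every $x\in V$; its Laplacian is $\Delta f(x)=\sum_y q(x,y)(f(y)-f(x))$. $G$ is reversible if there is $m:V\to(0,\infty)$ with $q(x,y)m(x)=q(y,x)m(y)$. For reversible $G$, $d$ is the combinatorial graph distance (finite since $G$ is connected). $q_{\min}:=\inf\{q(x,y):q(x,y)>0\}$. Ollivier curvature: for $x\ne y$ let $\nabla_{xy}f=(f(x)-f(y))/d(x,y)$, $\|\nabla f\|_\infty=\sup_{x\ne y}|\nabla_{xy}f|$, $\kappa(x,y)=\inf\{\nabla_{xy}\Delta f:\|\nabla f\|_\infty=1,\ \nabla_{yx}f=1\}$; non-negative curvature means $\kappa\ge0$ for all $x\ne y$. Heat semigroup of any graph: for finite $S$ let $q_S(x,y)=q(x,y)1_S(x)$ with Laplacian $\Delta_S$ and $P^S_tf=\sum_{k\ge0}t^k\Delta_S^k(f1_S)/k!$; for bounded $f$, $P_tf=\lim_iP_t^{S_i}f$ pointwise along any increasing finite exhaustion. $(f\otimes g)(x,y)=f(x)g(y)$.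 A coupling graph of $G$ is a graph $\widetilde G=(V\times V,\widetilde q)$ whose Laplacian satisfies $\widetilde\Delta(f\otimes 1)=\Delta f\otimes 1$ and $\widetilde\Delta(1\otimes f)=1\otimes\Delta f$ for all $f$. A transport plan from $x_0$ to $y_0$ is $\rho:V\times V\to[0,\infty)$ with $\sum_{y}\rho(x,y)=q(x_0,x)$ for $x\neq x_0$ and $\sum_x\rho(x,y)=q(y_0,y)$ for $y\ne y_0$; $\mathrm{cost}(\rho)=\sum_{x,y}\rho(x,y)(d(x_0,y_0)-d(x,y))$; $\mu_\rho(k)=\sum_{d(x,y)-d(x_0,y_0)=k}\rho(x,y)$; optimal = cost-maximizing. A coupling graph is perfect if each $\rho_{x_0y_0}:=\widetilde q((x_0,y_0),(\cdot,\cdot))$ is optimal, has $\mu_{\rho_{x_0y_0}}(k)=0$ for $|k|>1$, and has $\mu_{\rho_{x_0y_0}}(-1)\ge 2q_{\min}$ when $x_0\ne y_0$. $\phi_t(n):=P^{\mathbb N_0}_t1_{\mathbb N_+}(n)$, with $P^{\mathbb N_0}_t$ the heat semigroup of the graph on $\mathbb N_0$ with rates $q_0(x,y)=2q_{\min}$ if $|x-y|=1$ and $x>0$, and $0$ otherwise. *)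

(* Defs.v *)
From Stdlib Require Import Reals Lra Lia ZArith Arith List Classical ClassicalEpsilon.
Import ListNotations.
Open Scope R_scope.

Set Implicit Arguments.

Section General.
Variable T : Type.

Definition indic (S : T -> Prop) (x : T) : R :=
  if excluded_middle_informative (S x) then 1 else 0.

Definition lsum (g : T -> R) (l : list T) : R :=
  fold_right (fun y acc => g y + acc) 0 l.

(* sum of a finitely supported function (value unspecified otherwise) *)
Definition fsum (g : T -> R) : R :=
  epsilon (inhabits 0) (fun s => exists l, NoDup l /\
     (forall y, g y <> 0 -> In y l) /\ s = lsum g l).

(* sum of a non-negative function over a countable set: sup of finite partial sums *)
Definition has_sum (g : T -> R) (s : R) : Prop :=
  is_lub (fun r => exists l, NoDup l /\ r = lsum g l) s.

Definition countable_type : Prop := exists f : T -> nat, forall x y, f x = f y -> x = y.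

Definition finite_set (S : T -> Prop) : Prop := exists l : list T, forall x, S x -> In x l.

Definition is_graph (q : T -> T -> R) : Prop :=
  (forall x y, 0 <= q x y) /\ (forall x, finite_set (fun y => q x y > 0)).

Definition laplacian (q : T -> T -> R) (f : T -> R) (x : T) : R :=
  fsum (fun y => q x y * (f y - f x)).

Definition reversible (q : T -> T -> R) : Prop :=
  exists m : T -> R, (forall x, 0 < m x) /\ (forall x y, q x y * m x = q y x * m y).

Inductive reach (q : T -> T -> R) : nat -> T -> T -> Prop :=
| reach0 : forall x, reach q 0 x x
| reachS : forall n x y z, q x y > 0 -> reach q n y z -> reach q (S n) x z.

Definition connected (q : T -> T -> R) : Prop := forall x y, exists n, reach q n x y.

Definition gdist (q : T -> T -> R) (x y : T) : nat :=
  epsilon (inhabits 0%nat)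
    (fun n => reach q n x y /\ forall m, reach q m x y -> (n <= m)%nat).

Definition is_glb (E : R -> Prop) (m : R) : Prop :=
  (forall r, E r -> m <= r) /\ (forall b, (forall r, E r -> b <= r) -> b <= m).

Definition is_qmin (q : T -> T -> R) (m : R) : Prop :=
  is_glb (fun r => exists x y, q x y > 0 /\ r = q x y) m.

Definition grad (q : T -> T -> R) (x y : T) (f : T -> R) : R :=
  (f x - f y) / INR (gdist q x y).

Definition grad_sup_eq (q : T -> T -> R) (f : T -> R) (c : R) : Prop :=
  is_lub (fun r => exists u v, u <> v /\ r = Rabs (grad q u v f)) c.

(* kappa(x,y) >= 0 for all x <> y, i.e. every admissible f gives
   nabla_xy Delta f >= 0 (infimum of a set is >= 0 iff all elements are) *)
Definition nonneg_ollivier (q : T -> T -> R) : Prop :=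
  forall x y, x <> y -> forall f : T -> R,
    grad_sup_eq q f 1 -> grad q y x f = 1 -> 0 <= grad q x y (laplacian q f).

Definition qS (q : T -> T -> R) (S : T -> Prop) (x y : T) : R := q x y * indic S x.

Definition PS (q : T -> T -> R) (S : T -> Prop) (t : R) (f : T -> R) (x : T) : R :=
  epsilon (inhabits 0) (fun r =>
    Un_cv (fun n => sum_f_R0 (fun k =>
      t ^ k * Nat.iter k (laplacian (qS q S)) (fun y => f y * indic S y) x / INR (fact k)) n) r).

Definition exhaustion (S : nat -> T -> Prop) : Prop :=
  (forall i, finite_set (S i)) /\ (forall i x, S i x -> S (Datatypes.S i) x) /\
  (forall x, exists i, S i x).

Definition heat (q : T -> T -> R) (t : R) (f : T -> R) (x : T) : R :=
  epsilon (inhabits 0) (fun r =>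
    forall S, exhaustion S -> Un_cv (fun i => PS q (S i) t f x) r).

End General.

Section Coupling.
Variable V : Type.

Definition is_coupling (q : V -> V -> R) (qt : V * V -> V * V -> R) : Prop :=
  is_graph qt /\
  (forall (f : V -> R) (x y : V),
      laplacian qt (fun p => f (fst p)) (x, y) = laplacian q f x) /\
  (forall (f : V -> R) (x y : V),
      laplacian qt (fun p => f (snd p)) (x, y) = laplacian q f y).

Definition transport_plan (q : V -> V -> R) (x0 y0 : V) (rho : V * V -> R) : Prop :=
  (forall p, 0 <= rho p) /\
  (forall x, x <> x0 -> has_sum (fun y => rho (x, y)) (q x0 x)) /\
  (forall y, y <> y0 -> has_sum (fun x => rho (x, y)) (q y0 y)).

Definition cost (q : V -> V -> R) (x0 y0 : V) (rho : V * V -> R) : R :=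
  fsum (fun p => rho p * (INR (gdist q x0 y0) - INR (gdist q (fst p) (snd p)))).

Definition mu (q : V -> V -> R) (x0 y0 : V) (rho : V * V -> R) (k : Z) : R :=
  fsum (fun p => if Z.eq_dec (Z.of_nat (gdist q (fst p) (snd p)) - Z.of_nat (gdist q x0 y0)) k
                 then rho p else 0).

Definition optimal_plan (q : V -> V -> R) (x0 y0 : V) (rho : V * V -> R) : Prop :=
  transport_plan q x0 y0 rho /\
  (forall rho', transport_plan q x0 y0 rho' -> cost q x0 y0 rho' <= cost q x0 y0 rho).

Definition perfect_coupling (q : V -> V -> R) (qmin : R) (qt : V * V -> V * V -> R) : Prop :=
  is_coupling q qt /\
  forall x0 y0 : V,
    optimal_plan q x0 y0 (qt (x0, y0)) /\
    (forall k : Z, (Z.abs k > 1)%Z -> mu q x0 y0 (qt (x0, y0)) k = 0) /\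
    (x0 <> y0 -> 2 * qmin <= mu q x0 y0 (qt (x0, y0)) (-1)%Z).

End Coupling.

Definition q0 (qmin : R) (x y : nat) : R :=
  if (Nat.ltb 0 x && (Nat.eqb x (S y) || Nat.eqb y (S x)))%bool then 2 * qmin else 0.

Definition phi (qmin t : R) (n : nat) : R :=
  heat (q0 qmin) t (indic (fun m : nat => (0 < m)%nat)) n.

Definition offdiag (V : Type) (p : V * V) : Prop := fst p <> snd p.

(* Main.v *)
From Coquelicot Require Import Rcomplements Hierarchy Series PSeries ElemFct.
From Stdlib Require Import Lra Lia Arith List Classical ClassicalEpsilon
  FunctionalExtensionality Permutation FinFun.
Require Import Defs.
From Stdlib Require Import Reals.
Import ListNotations.
Open Scope R_scope.

(** Uniformization: if all rates on a finite set [A] are at most [L], the semigroup killed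
    outside [A] is the Poisson average of the powers of the Markov kernel [1 + Delta_A / L].
    It is therefore enough to compare these powers with those of the kernel of the half-line
    at the same rate [L], whose iterates [surv k] of the indicator of the positive integers are
    nondecreasing and concave.  For the coupling, the distance jumps by at most one, it
    decreases at rate at least [2 qmin] and increases at no larger rate; the latter holds
    because a Kantorovich potential of the optimal plan turns non-negative curvature into
    non-negativity of the optimal cost.  Hence [surv k] composed with the distance is a
    supersolution.

    By concavity [phi_t n <= n * phi_t 1], and at rate [4 qmin] the half-line kernel is the
    simple random walk, for which [surv k 1 = C(k, (k+1)/2) / 2^k <= 1 / sqrt (k + 1)].  With
    [s = 4 qmin t], AM-GM gives [sqrt s * surv k 1 <= (s / (k + 1) + 1) / 2], whose Poisson
    average is at most [1]. *)

Set Implicit Arguments.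

(** * Finite sums *)

Section FiniteSums.
Variable T : Type.
Implicit Types (g h : T -> R) (l : list T).

Lemma lsum_ext g h l : (forall y, In y l -> g y = h y) -> lsum g l = lsum h l.
Proof.
  induction l as [|a l IH]; simpl; intros H; auto.
  rewrite H by auto. rewrite IH; auto.
Qed.

Lemma lsum_plus g h l : lsum (fun y => g y + h y) l = lsum g l + lsum h l.
Proof. induction l as [|a l IH]; simpl; lra. Qed.

Lemma lsum_scal c g l : lsum (fun y => c * g y) l = c * lsum g l.
Proof. induction l as [|a l IH]; simpl; [lra|]. rewrite IH; ring. Qed.

Lemma lsum_le g h l : (forall y, In y l -> g y <= h y) -> lsum g l <= lsum h l.
Proof.
  induction l as [|a l IH]; simpl; intros H; [lra|].
  specialize (H a (or_introl eq_refl)) as H1.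
  assert (lsum g l <= lsum h l) by (apply IH; auto). lra.
Qed.

Lemma lsum_zero g l : (forall y, In y l -> g y = 0) -> lsum g l = 0.
Proof.
  induction l as [|a l IH]; simpl; intros H; auto.
  rewrite H, IH by auto; lra.
Qed.

Lemma lsum_nonneg g l : (forall y, In y l -> 0 <= g y) -> 0 <= lsum g l.
Proof.
  intros H. rewrite <- (lsum_zero (fun _ => 0) l) by auto. apply lsum_le; auto.
Qed.

Lemma lsum_nonneg_eq0 g l : (forall y, In y l -> 0 <= g y) -> lsum g l = 0 ->
  forall y, In y l -> g y = 0.
Proof.
  induction l as [|a l IH]; simpl; intros H H0 y Hy; [tauto|].
  assert (0 <= lsum g l) by (apply lsum_nonneg; auto).
  pose proof (H a (or_introl eq_refl)).
  destruct Hy as [<-|Hy]; [lra|]. apply IH; auto. lra.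
Qed.

Lemma lsum_perm g l l' : Permutation l l' -> lsum g l = lsum g l'.
Proof. induction 1; simpl; lra. Qed.

(** Dropping the zero terms leaves two duplicate-free lists with the same members. Hence the value
    chosen by [epsilon] in [fsum] does not depend on the list. *)
Lemma lsum_support g l l' : NoDup l -> NoDup l' ->
  (forall y, g y <> 0 -> In y l) -> (forall y, g y <> 0 -> In y l') ->
  lsum g l = lsum g l'.
Proof.
  set (P := fun y => if Req_EM_T (g y) 0 then false else true).
  assert (HP : forall y, P y = true <-> g y <> 0).
  { intros y. unfold P. destruct (Req_EM_T (g y) 0); split; congruence. }
  assert (Hf : forall m, lsum g m = lsum g (filter P m)).
  { induction m as [|a m IH]; simpl; auto. destruct (P a) eqn:E; simpl.
    - rewrite IH; auto.
    - rewrite <- IH. assert (g a = 0); [|lra]. apply NNPP. intros N.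
      apply HP in N. congruence. }
  intros N N' H H'. rewrite (Hf l), (Hf l'). apply lsum_perm.
  apply NoDup_Permutation; try apply NoDup_filter; auto.
  intros y. rewrite !filter_In, HP. firstorder.
Qed.

Lemma fsum_eq g l : NoDup l -> (forall y, g y <> 0 -> In y l) -> fsum g = lsum g l.
Proof.
  intros N H. unfold fsum.
  set (P := fun s => exists l, NoDup l /\ (forall y, g y <> 0 -> In y l) /\ s = lsum g l).
  destruct (epsilon_spec (inhabits 0) P) as (l' & N' & H' & E).
  - exists (lsum g l), l. auto.
  - rewrite E. apply lsum_support; auto.
Qed.

Lemma list_nodup l : exists l', NoDup l' /\ forall x, In x l' <-> In x l.
Proof.
  exists (nodup (fun x y => excluded_middle_informative (x = y)) l).
  split; [apply NoDup_nodup|]. intros x. apply nodup_In.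
Qed.

Lemma indic_in (A : T -> Prop) x : A x -> indic A x = 1.
Proof. intros H. unfold indic. destruct excluded_middle_informative; tauto. Qed.

Lemma indic_notin (A : T -> Prop) x : ~ A x -> indic A x = 0.
Proof. intros H. unfold indic. destruct excluded_middle_informative; tauto. Qed.

Lemma indic_bounds (A : T -> Prop) x : 0 <= indic A x <= 1.
Proof. unfold indic. destruct excluded_middle_informative; lra. Qed.

Lemma lsum_indic_eq p g l : NoDup l -> In p l ->
  lsum (fun y => indic (eq p) y * g y) l = g p.
Proof.
  intros N. induction N as [|a l Ha N IH]; simpl; [tauto|].
  intros [<-|Hp].
  - rewrite indic_in by auto. rewrite lsum_zero; [lra|].
    intros y Hy. rewrite indic_notin; [lra|]. congruence.
  - rewrite IH by auto. rewrite indic_notin; [lra|]. congruence.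
Qed.

(** Links the supremum in [transport_plan] to finite lists. Any competing list sits inside a list
    that also covers the support, and extra non-negative terms can only increase the sum. *)
Lemma has_sum_lsum g l : (forall y, 0 <= g y) -> NoDup l ->
  (forall y, g y <> 0 -> In y l) -> has_sum g (lsum g l).
Proof.
  intros Hg N H. split.
  - intros r (l' & N' & ->).
    destruct (list_nodup (l ++ l')) as (m & Nm & Hm).
    rewrite (@lsum_support g l m); auto.
    + assert (Hi : incl l' m) by (intros z Hz; apply Hm, in_app_iff; auto).
      clear - N' Nm Hg Hi. revert m Nm Hi.
      induction N' as [|a l' Ha N' IH]; intros m Nm Hi; simpl.
      * apply lsum_nonneg; auto.
      * destruct (in_split a m) as (m1 & m2 & ->); [apply Hi; simpl; auto|].
        rewrite (@lsum_perm g (m1 ++ a :: m2) (a :: m1 ++ m2))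
          by (symmetry; apply Permutation_middle).
        simpl. apply Rplus_le_compat_l. apply IH.
        -- eapply NoDup_remove_1; eauto.
        -- intros z Hz. assert (In z (m1 ++ a :: m2)) as K by (apply Hi; simpl; auto).
           apply in_app_iff in K. apply in_app_iff. simpl in K.
           destruct K as [K|[K|K]]; auto. congruence.
    + intros y Hy. apply Hm, in_app_iff. auto.
  - intros b Hb. apply Hb. eauto.
Qed.

End FiniteSums.

(** * Laplacians of graphs *)

Section Laplacian.
Variables (T : Type) (q : T -> T -> R).
Hypothesis Hq : is_graph q.

Definition degree (x : T) : R := fsum (q x).

Lemma neighbours x : exists l, NoDup l /\ forall y, q x y <> 0 -> In y l.
Proof.
  destruct Hq as [H0 Hf]. destruct (Hf x) as [l Hl].
  destruct (list_nodup l) as (l' & N & E). exists l'. split; auto.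
  intros y Hy. apply E, Hl. specialize (H0 x y). lra.
Qed.

Lemma laplacian_lsum x l g : NoDup l -> (forall y, q x y <> 0 -> In y l) ->
  laplacian q g x = lsum (fun y => q x y * (g y - g x)) l.
Proof.
  intros N H. apply fsum_eq; auto. intros y Hy. apply H. intros E. apply Hy.
  rewrite E. ring.
Qed.

Lemma laplacian_lin c g h x :
  laplacian q (fun y => c * g y + h y) x = c * laplacian q g x + laplacian q h x.
Proof.
  destruct (neighbours x) as (l & N & H). rewrite !(laplacian_lsum _ N H).
  rewrite <- lsum_scal, <- lsum_plus. apply lsum_ext. intros; ring.
Qed.

Lemma laplacian_scal c g x : laplacian q (fun y => c * g y) x = c * laplacian q g x.
Proof.
  destruct (neighbours x) as (l & N & H). rewrite !(laplacian_lsum _ N H).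
  rewrite <- lsum_scal. apply lsum_ext. intros; ring.
Qed.

Lemma laplacian_sum (c : nat -> R) (g : nat -> T -> R) k x :
  laplacian q (fun y => sum_f_R0 (fun j => c j * g j y) k) x =
  sum_f_R0 (fun j => c j * laplacian q (g j) x) k.
Proof.
  induction k as [|k IH]; simpl.
  - apply laplacian_scal.
  - rewrite <- IH, Rplus_comm, <- laplacian_lin. f_equal.
    apply functional_extensionality. intros; ring.
Qed.

Lemma laplacian_qS (A : T -> Prop) g x :
  laplacian (qS q A) g x = indic A x * laplacian q g x.
Proof.
  destruct (neighbours x) as (l & N & H). rewrite (laplacian_lsum _ N H).
  rewrite <- lsum_scal. unfold laplacian. rewrite (@fsum_eq _ _ l); auto.
  - apply lsum_ext. intros; unfold qS; ring.
  - intros y Hy. apply H. intros E. apply Hy. unfold qS. rewrite E. ring.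
Qed.

Lemma is_graph_qS (A : T -> Prop) : is_graph (qS q A).
Proof.
  destruct Hq as [H0 Hf]. split.
  - intros x y. unfold qS. pose proof (indic_bounds A x). apply Rmult_le_pos; [auto|lra].
  - intros x. destruct (Hf x) as [l Hl]. exists l. intros y Hy. apply Hl.
    unfold qS in Hy. specialize (H0 x y). destruct H0 as [?|E]; auto.
    rewrite <- E in Hy. lra.
Qed.

Lemma laplacian_degree g x l : NoDup l -> (forall y, q x y <> 0 -> In y l) ->
  laplacian q g x = lsum (fun y => q x y * g y) l - degree x * g x.
Proof.
  intros N H. rewrite (laplacian_lsum _ N H). unfold degree.
  rewrite (@fsum_eq _ _ l) by auto.
  assert (E : lsum (q x) l * g x = lsum (fun y => g x * q x y) l)
    by (rewrite lsum_scal; ring).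
  rewrite E. replace (lsum (fun y => g x * q x y) l)
    with (- lsum (fun y => -1 * (g x * q x y)) l) by (rewrite lsum_scal; ring).
  unfold Rminus. rewrite Ropp_involutive, <- lsum_plus. apply lsum_ext. intros; ring.
Qed.

(** The kernel is positive: the coefficient of [g x] coming from the diagonal is
    [(L - degree x) / L], and the remaining coefficients are rates divided by [L]. *)
Lemma step_mono (L : R) g h x : 0 < L -> degree x <= L -> (forall y, g y <= h y) ->
  g x + laplacian q g x / L <= h x + laplacian q h x / L.
Proof.
  intros HL Hd Hgh. destruct (neighbours x) as (l & N & H).
  rewrite !(laplacian_degree _ N H).
  assert (lsum (fun y => q x y * g y) l <= lsum (fun y => q x y * h y) l).
  { apply lsum_le. intros y _. apply Rmult_le_compat_l; auto. apply Hq. }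
  apply Rmult_le_reg_l with L; auto.
  field_simplify; try lra. pose proof (Hgh x). nra.
Qed.

(* One step of the Markov chain obtained from the generator [laplacian (qS q A)] by
   uniformization at rate [L]. *)
Definition unif_step (L : R) (A : T -> Prop) (g : T -> R) (x : T) : R :=
  g x + laplacian (qS q A) g x / L.

Definition unif_iter (L : R) (A : T -> Prop) (f : T -> R) (k : nat) : T -> R :=
  Nat.iter k (unif_step L A) (fun y => f y * indic A y).

Lemma unif_iter_outside L A f k x : ~ A x -> unif_iter L A f k x = 0.
Proof.
  intros Hx. induction k as [|k IH]; simpl.
  - rewrite indic_notin by auto. ring.
  - fold (unif_iter L A f k). unfold unif_step. rewrite IH, laplacian_qS, indic_notin by auto.
    lra.
Qed.

Lemma unif_iter_S L (A : T -> Prop) f k x : A x ->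
  unif_iter L A f (S k) x = unif_iter L A f k x + laplacian q (unif_iter L A f k) x / L.
Proof.
  intros Hx. simpl. fold (unif_iter L A f k). unfold unif_step.
  rewrite laplacian_qS, indic_in by auto. lra.
Qed.

(** A discrete comparison principle: positivity of the kernel propagates domination by a
    supersolution [w] on [A], and outside [A] the iterate vanishes, so [0 <= w] suffices there. *)
Lemma unif_iter_le L (A : T -> Prop) f (w : nat -> T -> R) : 0 < L ->
  (forall x, A x -> degree x <= L) -> (forall k x, 0 <= w k x) ->
  (forall x, f x <= w O x) ->
  (forall k x, A x -> w k x + laplacian q (w k) x / L <= w (S k) x) ->
  forall k x, unif_iter L A f k x <= w k x.
Proof.
  intros HL Hd Hw H0 HS. induction k as [|k IH]; intros x.
  - unfold unif_iter. simpl. destruct (classic (A x)).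
    + rewrite indic_in by auto. rewrite Rmult_1_r; auto.
    + rewrite indic_notin by auto. rewrite Rmult_0_r; auto.
  - destruct (classic (A x)) as [Hx|Hx].
    + rewrite unif_iter_S by auto. eapply Rle_trans; [|apply HS; auto].
      apply step_mono; auto.
    + rewrite unif_iter_outside; auto.
Qed.

Lemma laplacian_const c x : laplacian q (fun _ => c) x = 0.
Proof.
  destruct (neighbours x) as (l & N & H). rewrite (laplacian_lsum _ N H).
  apply lsum_zero. intros; ring.
Qed.

Lemma unif_iter_nonneg L (A : T -> Prop) f : 0 < L ->
  (forall x, A x -> degree x <= L) -> (forall x, 0 <= f x) ->
  forall k x, 0 <= unif_iter L A f k x.
Proof.
  intros HL Hd Hf. induction k as [|k IH]; intros x.
  - apply Rmult_le_pos; auto. apply indic_bounds.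
  - destruct (classic (A x)) as [Hx|Hx].
    + rewrite unif_iter_S by auto.
      pose proof (@step_mono L (fun _ => 0) (unif_iter L A f k) x HL (Hd x Hx) IH) as K.
      rewrite laplacian_const in K. lra.
    + rewrite unif_iter_outside; auto; lra.
Qed.

Lemma unif_iter_bounds L (A : T -> Prop) f : 0 < L ->
  (forall x, A x -> degree x <= L) -> (forall x, 0 <= f x <= 1) ->
  forall k x, 0 <= unif_iter L A f k x <= 1.
Proof.
  intros HL Hd Hf k x. split.
  - apply unif_iter_nonneg; auto. intros; apply Hf.
  - apply (@unif_iter_le L A f (fun _ _ => 1)); auto.
    + intros; lra.
    + intros; apply Hf.
    + intros. rewrite laplacian_const. lra.
Qed.

Lemma unif_iter_mono L (A B : T -> Prop) f : 0 < L ->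
  (forall x, B x -> degree x <= L) -> (forall x, 0 <= f x) -> (forall x, A x -> B x) ->
  forall k x, unif_iter L A f k x <= unif_iter L B f k x.
Proof.
  intros HL Hd Hf HAB. induction k as [|k IH]; intros x.
  - apply Rmult_le_compat_l; auto. destruct (classic (A x)).
    + rewrite !indic_in by auto. lra.
    + rewrite indic_notin by auto. apply indic_bounds.
  - destruct (classic (A x)) as [Hx|Hx].
    + rewrite !unif_iter_S by auto. apply step_mono; auto.
    + rewrite unif_iter_outside by auto. apply unif_iter_nonneg; auto.
Qed.

(** With [c = 4 * qmin], a single rate [L] uniformizes both the coupling on [A] and the
    half-line. *)
Lemma degree_bound (A : T -> Prop) (c : R) : finite_set A ->
  exists L, 0 < L /\ c <= L /\ forall x, A x -> degree x <= L.
Proof.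
  intros [l Hl].
  assert (exists L, 0 < L /\ c <= L /\ forall x, In x l -> degree x <= L) as (L & H1 & H2 & H3).
  { clear Hl. induction l as [|a l (L & H1 & H2 & H3)].
    - exists (Rmax 1 c). pose proof (Rmax_l 1 c). pose proof (Rmax_r 1 c).
      split; [lra|]. split; [lra|]. simpl; tauto.
    - exists (Rmax L (degree a)). pose proof (Rmax_l L (degree a)).
      pose proof (Rmax_r L (degree a)). split; [lra|]. split; [lra|].
      intros x [<-|Hx]; auto. specialize (H3 x Hx). lra. }
  exists L; auto.
Qed.

End Laplacian.

(** * Binomial coefficients *)

Fixpoint binom (n k : nat) : nat :=
  match n, k with
  | _, O => 1
  | O, S _ => 0
  | S n', S k' => binom n' k' + binom n' (S k')
  end.

Lemma binom_0_r n : binom n 0 = 1%nat.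
Proof. destruct n; auto. Qed.

Lemma binom_gt n : forall k, (n < k)%nat -> binom n k = 0%nat.
Proof.
  induction n as [|n IH]; intros [|k] H; simpl; try lia. rewrite !IH; lia.
Qed.

(** Stated with [j + i = n] and products only, to stay in the naturals. In the inductive step,
    Pascal's rule adds two induction instances with weights [S j] and [S i]. *)
Lemma binom_fact n : forall j i, (j + i = n)%nat ->
  (binom n j * fact j * fact i = fact n)%nat.
Proof.
  induction n as [|n IH]; intros j i E.
  - assert (j = 0 /\ i = 0)%nat as [-> ->] by lia. reflexivity.
  - destruct j as [|j].
    + rewrite binom_0_r. simpl in E. subst i. simpl fact at 1. lia.
    + destruct i as [|i].
      * assert (n = j) as -> by lia. change (binom (S j) (S j)) with (binom j j + binom j (S j))%nat.
        rewrite (binom_gt (n:=j) (k:=S j)) by lia. specialize (IH j O ltac:(lia)).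
        simpl fact in *. nia.
      * change (binom (S n) (S j)) with (binom n j + binom n (S j))%nat.
        pose proof (IH j (S i) ltac:(lia)). pose proof (IH (S j) i ltac:(lia)).
        change (fact (S n)) with (S n * fact n)%nat.
        change (fact (S j)) with (S j * fact j)%nat in *.
        change (fact (S i)) with (S i * fact i)%nat in *.
        replace (S n) with (S j + S i)%nat by lia. nia.
Qed.

Lemma binom_sym j i : binom (j + i) j = binom (j + i) i.
Proof.
  pose proof (@binom_fact (j + i) j i ltac:(lia)).
  pose proof (@binom_fact (j + i) i j ltac:(lia)).
  pose proof (lt_O_fact j). pose proof (lt_O_fact i).
  assert (0 < fact j * fact i)%nat by nia.
  apply Nat.mul_cancel_r with (fact j * fact i)%nat; nia.
Qed.

(** * Exponential series and Poisson averages *)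

Lemma pow_m1_sq n : (-1) ^ n * (-1) ^ n = 1.
Proof. rewrite <- Rpow_mult_distr. replace (-1 * -1) with 1 by ring. apply pow1. Qed.

Lemma sum_shift (f : nat -> R) k :
  sum_f_R0 f (S k) = f O + sum_f_R0 (fun j => f (S j)) k.
Proof. rewrite decomp_sum by lia. simpl. reflexivity. Qed.

(** The [k]-th finite difference of the first differences is the [(k+1)]-st finite difference: shift
    the index and apply Pascal's rule. *)
Lemma binom_diff (a : nat -> R) k :
  sum_f_R0 (fun j => INR (binom k j) * (-1) ^ (k + j) * (a (S j) - a j)) k =
  sum_f_R0 (fun j => INR (binom (S k) j) * (-1) ^ (S k + j) * a j) (S k).
Proof.
  rewrite (sum_shift (fun j => INR (binom (S k) j) * (-1) ^ (S k + j) * a j)).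
  set (F := fun j => INR (binom k j) * (-1) ^ (k + j) * a j).
  (* The sum may be extended to index [S k], because [binom k (S k) = 0]. *)
  assert (E : sum_f_R0 F k = F O + sum_f_R0 (fun j => F (S j)) k).
  { rewrite <- sum_shift. simpl. unfold F at 3. rewrite binom_gt by lia. simpl. ring. }
  rewrite (sum_eq _ (fun j => INR (binom k j) * (-1) ^ (k + j) * a (S j) - F j))
    by (intros; unfold F; ring).
  rewrite minus_sum, E.
  rewrite (sum_eq (fun j => INR (binom (S k) (S j)) * (-1) ^ (S k + S j) * a (S j))
     (fun j => INR (binom k j) * (-1) ^ (k + j) * a (S j) - F (S j))).
  - rewrite minus_sum. unfold F at 1. rewrite !binom_0_r. simpl. ring.
  - intros j _. unfold F. change (binom (S k) (S j)) with (binom k j + binom k (S j))%nat.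
    rewrite plus_INR. rewrite Nat.add_succ_r. simpl. rewrite Nat.add_succ_r. simpl. ring.
Qed.

Definition expo_term (s : R) (k : nat) : R := s ^ k / INR (fact k).

Lemma is_series_exp s : is_series (expo_term s) (exp s).
Proof.
  pose proof (is_exp_Reals s) as H. unfold is_pseries in H.
  eapply is_series_ext; [|exact H]. intros n. simpl. unfold expo_term, scal. simpl.
  unfold mult. simpl. rewrite pow_n_pow. reflexivity.
Qed.

Lemma expo_term_nonneg s k : 0 <= s -> 0 <= expo_term s k.
Proof.
  intros H. apply Rdiv_le_0_compat; [apply pow_le; auto|apply INR_fact_lt_0].
Qed.

Definition bounded01 (a : nat -> R) : Prop := forall k, 0 <= a k <= 1.

Lemma ex_series_expo_abs s a : bounded01 a ->
  ex_series (fun k => Rabs (expo_term s k * a k)).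
Proof.
  intros Ha. apply (@ex_series_le R_AbsRing R_CompleteNormedModule _ (expo_term (Rabs s))).
  - intros n. unfold norm; simpl. unfold abs; simpl. rewrite Rabs_Rabsolu, Rabs_mult.
    unfold expo_term, Rdiv. rewrite Rabs_mult, <- RPow_abs.
    rewrite (Rabs_pos_eq (/ _)) by (left; apply Rinv_0_lt_compat, INR_fact_lt_0).
    rewrite (Rabs_pos_eq (a n)) by apply Ha.
    rewrite <- (Rmult_1_r (Rabs s ^ n * / INR (fact n))) at 2.
    apply Rmult_le_compat_l; [|apply Ha].
    apply Rmult_le_pos; [apply pow_le, Rabs_pos|].
    left; apply Rinv_0_lt_compat, INR_fact_lt_0.
  - exists (exp (Rabs s)). apply is_series_exp.
Qed.

Lemma ex_series_expo s a : bounded01 a -> ex_series (fun k => expo_term s k * a k).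
Proof. intros H. apply ex_series_Rabs, ex_series_expo_abs; auto. Qed.

Definition poisson (s : R) (a : nat -> R) : R :=
  exp (- s) * Series (fun k => expo_term s k * a k).

Lemma is_series_poisson s a : bounded01 a ->
  is_series (fun k => exp (- s) * (expo_term s k * a k)) (poisson s a).
Proof.
  intros Ha.
  exact (is_series_scal_l (exp (- s)) _ _ (Series_correct _ (ex_series_expo s Ha))).
Qed.

Lemma poisson_le s a b : 0 <= s -> (forall k, 0 <= a k <= b k) -> bounded01 b ->
  poisson s a <= poisson s b.
Proof.
  intros Hs H Hb. apply Rmult_le_compat_l; [left; apply exp_pos|].
  apply Series_le; [|apply ex_series_expo; auto].
  intros n. pose proof (expo_term_nonneg n Hs). specialize (H n). split.
  - apply Rmult_le_pos; tauto.
  - apply Rmult_le_compat_l; tauto.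
Qed.

Lemma poisson_le_1 s a : 0 <= s -> bounded01 a -> poisson s a <= 1.
Proof.
  intros Hs Ha. eapply Rle_trans.
  - apply (@poisson_le s a (fun _ => 1)); auto. intros k. lra.
  - unfold poisson. rewrite (Series_ext _ (expo_term s)) by (intros; ring).
    rewrite (is_series_unique _ _ (is_series_exp s)), <- exp_plus, Rplus_opp_l, exp_0. lra.
Qed.

(* The exponential of [L (K - 1)] is the Poisson average of the powers of [K]; here
   [a k] stands for [K^k g x], and the left-hand side is its binomial transform, with
   [(-1)^(k+j)] in place of [(-1)^(k-j)] to avoid truncated subtraction. *)
Lemma is_series_binom_transform s a : bounded01 a ->
  is_series (fun k => expo_term s k *
     sum_f_R0 (fun j => INR (binom k j) * (-1) ^ (k + j) * a j) k) (poisson s a).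
Proof.
  intros Ha.
  assert (H1 : is_series (fun k => expo_term s k * a k) (Series (fun k => expo_term s k * a k)))
    by (apply Series_correct, ex_series_expo; auto).
  assert (H3 : ex_series (fun k => Rabs (expo_term (- s) k))).
  { eapply ex_series_ext; [|apply (@ex_series_expo_abs (-s) (fun _ => 1))].
    - intros n; simpl. rewrite Rmult_1_r; reflexivity.
    - intros k; lra. }
  (* The transform is the Cauchy product of the series of [expo_term s k * a k] with that of
     [exp (- s)]; both converge absolutely. *)
  pose proof (is_series_mult _ _ _ _ H1 (is_series_exp (- s))
    (ex_series_expo_abs s Ha) H3) as H.
  unfold poisson. rewrite Rmult_comm. eapply is_series_ext; [|exact H].
  intros n. simpl. rewrite scal_sum. apply sum_eq. intros j Hj.
  assert (exists i, n = j + i)%nat as [i ->] by (exists (n - j)%nat; lia).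
  replace (j + i - j)%nat with i by lia.
  pose proof (@binom_fact (j + i) j i eq_refl) as E. apply (f_equal INR) in E.
  rewrite !mult_INR in E. unfold expo_term. rewrite <- E.
  (* The sign [(-1) ^ (n + j)] reduces to [(-1) ^ i], which is the sign of the [i]-th term of
     [exp (- s)]. *)
  replace (j + i + j)%nat with (i + (j + j))%nat by lia. rewrite !pow_add, pow_m1_sq.
  replace (- s) with (-1 * s) by ring. rewrite Rpow_mult_distr.
  pose proof (INR_fact_neq_0 j). pose proof (INR_fact_neq_0 i).
  assert (INR (binom (j + i) j) <> 0).
  { intros Z. rewrite Z in E. pose proof (INR_fact_neq_0 (j + i)). lra. }
  field. auto.
Qed.

Lemma partial_sum_le_series (b : nat -> R) l n : (forall k, 0 <= b k) -> is_series b l ->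
  sum_f_R0 b n <= l.
Proof.
  intros Hb H. apply sum_incr; auto. apply is_series_Reals in H. exact H.
Qed.

(** * The heat semigroup *)

Section Heat.
Variables (T : Type) (q : T -> T -> R).
Hypothesis Hq : is_graph q.

(** With [K] the uniformized kernel, the killed generator is [L (K - 1)]; this is the binomial
    expansion of its [k]-th power, built one difference at a time by [binom_diff]. *)
Lemma iter_laplacian_unif L (A : T -> Prop) f k : 0 < L -> forall x,
  Nat.iter k (laplacian (qS q A)) (fun y => f y * indic A y) x =
  L ^ k * sum_f_R0 (fun j => INR (binom k j) * (-1) ^ (k + j) * unif_iter q L A f j x) k.
Proof.
  intros HL. pose proof (is_graph_qS Hq A) as HqA.
  induction k as [|k IH]; intros x.
  - simpl. unfold unif_iter. simpl. ring.
  - simpl Nat.iter.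
    rewrite (functional_extensionality _ _ IH).
    rewrite laplacian_scal, laplacian_sum, <- binom_diff by auto.
    simpl pow. rewrite (Rmult_comm L), Rmult_assoc. f_equal.
    rewrite scal_sum. apply sum_eq. intros j _.
    change (unif_iter q L A f (S j) x) with
      (unif_iter q L A f j x + laplacian (qS q A) (unif_iter q L A f j) x / L).
    change (fun y => unif_iter q L A f j y) with (unif_iter q L A f j).
    field. lra.
Qed.

Lemma PS_eq (A : T -> Prop) t f x r :
  Un_cv (fun n => sum_f_R0 (fun k =>
      t ^ k * Nat.iter k (laplacian (qS q A)) (fun y => f y * indic A y) x / INR (fact k)) n) r ->
  PS q A t f x = r.
Proof.
  intros H. unfold PS.
  match goal with |- epsilon ?i ?P = _ => pose proof (epsilon_spec i P (ex_intro _ r H)) as K end.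
  simpl in K. eapply UL_sequence; eauto.
Qed.

Lemma PS_poisson L (A : T -> Prop) t f x : 0 < L -> (forall y, A y -> degree q y <= L) ->
  (forall y, 0 <= f y <= 1) ->
  PS q A t f x = poisson (L * t) (fun k => unif_iter q L A f k x).
Proof.
  intros HL Hd Hf. apply PS_eq. apply is_series_Reals.
  eapply is_series_ext; [|apply is_series_binom_transform].
  - intros k. simpl. rewrite (iter_laplacian_unif _ _ _ HL). unfold expo_term.
    rewrite Rpow_mult_distr. pose proof (INR_fact_neq_0 k). field. auto.
  - intros k. apply unif_iter_bounds; auto.
Qed.

(** A rate valid on the larger set serves both sets, so the comparison reduces to the kernel
    powers. *)
Lemma PS_mono (A B : T -> Prop) t f x : 0 <= t -> finite_set B -> (forall y, A y -> B y) ->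
  (forall y, 0 <= f y <= 1) -> PS q A t f x <= PS q B t f x.
Proof.
  intros Ht HB HAB Hf. destruct (degree_bound q 0 HB) as (L & HL & _ & Hd).
  rewrite (@PS_poisson L), (@PS_poisson L B) by auto.
  apply poisson_le.
  - nra.
  - intros k. split.
    + apply unif_iter_nonneg; auto. intros; apply Hf.
    + apply unif_iter_mono; auto. intros; apply Hf.
  - intros k. apply unif_iter_bounds; auto.
Qed.

Lemma exhaustion_le (A : nat -> T -> Prop) i j x : exhaustion A -> (i <= j)%nat ->
  A i x -> A j x.
Proof. intros (_ & H & _) Hij. induction Hij; auto. Qed.

Lemma exhaustion_finite (A : nat -> T -> Prop) (B : T -> Prop) : exhaustion A ->
  finite_set B -> exists i, forall x, B x -> A i x.
Proof.
  intros HA [l Hl].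
  assert (exists i, forall x, In x l -> A i x) as [i Hi].
  { clear Hl. induction l as [|a l [i IH]].
    - exists O. simpl; tauto.
    - destruct HA as (? & ? & HA3). destruct (HA3 a) as [j Hj].
      exists (max i j). intros x [<-|Hx].
      + eapply exhaustion_le with (i := j); eauto; [split; auto|lia].
      + eapply exhaustion_le with (i := i); eauto; [split; auto|lia]. }
  exists i; auto.
Qed.

Lemma heat_cv t f x : 0 <= t -> (forall y, 0 <= f y <= 1) ->
  forall A, exhaustion A -> Un_cv (fun i => PS q (A i) t f x) (heat q t f x).
Proof.
  intros Ht Hf. unfold heat.
  match goal with |- context [epsilon ?i ?P] => apply (epsilon_spec i P) end.
  (* The candidate limit is the supremum over all finite sets. It does not refer to an exhaustion,
     and each exhaustion eventually contains any given finite set, so all of them yield this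
     limit. *)
  destruct (completeness (fun r => exists A, finite_set A /\ r = PS q A t f x)) as [m [Hm1 Hm2]].
  - exists 1. intros r (A & HA & ->). destruct (degree_bound q 0 HA) as (L & HL & _ & Hd).
    rewrite (@PS_poisson L) by auto. apply poisson_le_1; [nra|].
    intros k. apply unif_iter_bounds; auto.
  - exists (PS q (fun _ => False) t f x), (fun _ => False). split; auto. exists nil. tauto.
  - exists m. intros A HA eps He.
    assert (exists B, finite_set B /\ m - eps < PS q B t f x) as (B & HB & Hlt).
    { apply NNPP. intros N. assert (m <= m - eps); [|lra]. apply Hm2.
      intros r (B & HB & ->). apply Rnot_lt_le. intros Hlt. apply N. eauto. }
    destruct (exhaustion_finite HA HB) as [i Hi]. exists i. intros n Hn.
    assert (PS q B t f x <= PS q (A n) t f x).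
    { apply PS_mono; auto; [apply HA|]. intros y Hy. eapply exhaustion_le; eauto. }
    assert (PS q (A n) t f x <= m).
    { apply Hm1. exists (A n). split; auto. apply HA. }
    unfold R_dist. rewrite Rabs_left1; lra.
Qed.

Lemma heat_le t f x r A : 0 <= t -> (forall y, 0 <= f y <= 1) -> exhaustion A ->
  (forall i, PS q (A i) t f x <= r) -> heat q t f x <= r.
Proof.
  intros Ht Hf HA H. eapply Rle_cv_lim; [exact H| |].
  - apply heat_cv; auto.
  - intros eps He. exists O. intros. unfold R_dist. rewrite Rminus_diag, Rabs_R0. auto.
Qed.

End Heat.

(** * The half-line *)

(* [surv th k n] is the probability that a lazy walk on the integers started at [n],
   moving to either neighbour with probability [th], avoids [0] up to time [k]. *)
Fixpoint surv (th : R) (k n : nat) : R :=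
  match k, n with
  | _, O => 0
  | O, S _ => 1
  | S k', S m => surv th k' (S m) + th * (surv th k' m + surv th k' (S (S m)) - 2 * surv th k' (S m))
  end.

Definition surv_incr (th : R) (k n : nat) : R := surv th k (S n) - surv th k n.

Lemma surv_0 th k : surv th k O = 0.
Proof. destruct k; auto. Qed.

Lemma surv_S th k n : surv th (S k) (S n) =
  surv th k (S n) + th * (surv th k n + surv th k (S (S n)) - 2 * surv th k (S n)).
Proof. reflexivity. Qed.

(** Taking increments turns the absorbing boundary at [0] into a reflecting one, so that positivity
    is visibly preserved. *)
Lemma surv_incr_S_0 th k :
  surv_incr th (S k) 0 = (1 - th) * surv_incr th k 0 + th * surv_incr th k 1.
Proof. unfold surv_incr. rewrite surv_S, !surv_0. ring. Qed.

Lemma surv_incr_S_S th k n : surv_incr th (S k) (S n) =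
  (1 - 2 * th) * surv_incr th k (S n) + th * (surv_incr th k n + surv_incr th k (S (S n))).
Proof. unfold surv_incr. rewrite !surv_S. ring. Qed.

(** Monotonicity and concavity of [surv th k]. The new difference of consecutive increments combines
    old ones with weights [1 - 2 * th] and [th], which are non-negative for [th <= 1/2]; at the
    boundary only one neighbour enters. *)
Lemma surv_incr_decr th k n : 0 <= th <= 1/2 ->
  0 <= surv_incr th k (S n) <= surv_incr th k n.
Proof.
  intros Hth. revert n. induction k as [|k IH]; intros n.
  - unfold surv_incr. destruct n; simpl; lra.
  - destruct n as [|n].
    + rewrite surv_incr_S_0, surv_incr_S_S.
      pose proof (IH O). pose proof (IH 1%nat). split; nra.
    + rewrite !surv_incr_S_S.
      pose proof (IH n). pose proof (IH (S n)). pose proof (IH (S (S n))). split; nra.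
Qed.

Lemma surv_incr_nonneg th k n : 0 <= th <= 1/2 -> 0 <= surv_incr th k n.
Proof. intros H. pose proof (@surv_incr_decr th k n H). lra. Qed.

Lemma surv_bounds th k n : 0 <= th <= 1/2 -> 0 <= surv th k n <= 1.
Proof.
  intros Hth. revert n. induction k as [|k IH]; intros [|n]; try (simpl; lra).
  rewrite surv_S. pose proof (IH n). pose proof (IH (S n)). pose proof (IH (S (S n))).
  split; nra.
Qed.

(** By concavity each of the [n] increments is at most the first one, which is [surv th k 1] since
    [surv] vanishes at [0]. *)
Lemma surv_le_linear th k n : 0 <= th <= 1/2 -> surv th k n <= INR n * surv th k 1.
Proof.
  intros Hth.
  assert (H : forall m, surv_incr th k m <= surv th k 1).
  { induction m as [|m IH].
    - unfold surv_incr. rewrite surv_0. lra.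
    - pose proof (@surv_incr_decr th k m Hth). lra. }
  induction n as [|n IH].
  - rewrite surv_0. simpl. lra.
  - rewrite S_INR. specialize (H n). unfold surv_incr in H. lra.
Qed.

(** For [th = 1/2] the increments scaled by [2 ^ k] obey Pascal's rule; the index rounds because the
    walk changes parity at every step. *)
Lemma surv_incr_binom k : forall n,
  surv_incr (1/2) k n * 2 ^ k = INR (binom k ((k + n + 1) / 2)).
Proof.
  induction k as [|k IH]; intros n.
  - unfold surv_incr. destruct n as [|n]; [simpl; lra|].
    replace (0 + S n + 1)%nat with (n + 1 * 2)%nat by lia.
    rewrite Nat.div_add by lia. replace (n / 2 + 1)%nat with (S (n / 2)) by lia. simpl. lra.
  - replace (S k + n + 1)%nat with (k + n + 1 * 2)%nat by lia.
    rewrite Nat.div_add by lia. replace ((k + n) / 2 + 1)%nat with (S ((k + n) / 2)) by lia.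
    change (binom (S k) (S ((k + n) / 2)))
      with (binom k ((k + n) / 2) + binom k (S ((k + n) / 2)))%nat.
    rewrite plus_INR. simpl pow.
    assert (E : surv_incr (1/2) k (S n) * 2 ^ k = INR (binom k (S ((k + n) / 2)))).
    { rewrite IH. do 2 f_equal. replace (k + S n + 1)%nat with (k + n + 1 * 2)%nat by lia.
      rewrite Nat.div_add by lia. lia. }
    destruct n as [|n].
    + rewrite surv_incr_S_0, <- E.
      (* The reflecting boundary needs the central coefficient at [k / 2] rather than at
         [(k + 1) / 2]. These indices agree for even [k] and are exchanged by the symmetry of
         binomials for odd [k]. *)
      assert (E0 : surv_incr (1/2) k 0 * 2 ^ k = INR (binom k ((k + 0) / 2))).
      { rewrite IH. f_equal. rewrite Nat.add_0_r.
        pose proof (Nat.div_mod_eq k 2). pose proof (Nat.mod_upper_bound k 2).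
        set (m := (k / 2)%nat) in *. destruct (k mod 2) as [|[|]] eqn:Ek; try lia.
        - replace (k + 1)%nat with (1 + m * 2)%nat by lia. rewrite Nat.div_add by lia.
          reflexivity.
        - replace (k + 1)%nat with (0 + S m * 2)%nat by lia. rewrite Nat.div_add by lia.
          simpl. replace k with (S m + m)%nat by lia. apply binom_sym. }
      rewrite <- E0. lra.
    + rewrite surv_incr_S_S, <- E.
      assert (E0 : surv_incr (1/2) k n * 2 ^ k = INR (binom k ((k + S n) / 2))).
      { rewrite IH. do 3 f_equal. lia. }
      rewrite <- E0. lra.
Qed.

Lemma surv_1_binom k : surv (1/2) k 1 * 2 ^ k = INR (binom k ((k + 1) / 2)).
Proof.
  pose proof (surv_incr_binom k 0) as H. unfold surv_incr in H.
  rewrite surv_0, Rminus_0_r, Nat.add_0_r in H. exact H.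
Qed.

Lemma binom_mid m :
  (binom (S (2 * m)) (S m) * (m + 1) = (2 * m + 1) * binom (2 * m) m)%nat /\
  binom (S (S (2 * m))) (S m) = (2 * binom (S (2 * m)) (S m))%nat.
Proof.
  pose proof (@binom_fact (2 * m) m m ltac:(lia)) as E1.
  pose proof (@binom_fact (S (2 * m)) (S m) m ltac:(lia)) as E2.
  split.
  - change (fact (S m)) with (S m * fact m)%nat in E2.
    change (fact (S (2 * m))) with (S (2 * m) * fact (2 * m))%nat in E2.
    pose proof (lt_O_fact m). assert (0 < fact m * fact m)%nat by nia.
    apply Nat.mul_cancel_r with (fact m * fact m)%nat; nia.
  - change (binom (S (S (2 * m))) (S m))
      with (binom (S (2 * m)) m + binom (S (2 * m)) (S m))%nat.
    replace (S (2 * m)) with (m + S m)%nat by lia. rewrite binom_sym. lia.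
Qed.

(** The second equality reflects parity: from [1], a surviving walk is at position at least [2] at
    odd times and cannot reach [0] in the next step. *)
Lemma surv_1_even_odd m :
  surv (1/2) (S (2 * m)) 1 * (2 * INR m + 2) = (2 * INR m + 1) * surv (1/2) (2 * m) 1 /\
  surv (1/2) (S (S (2 * m))) 1 = surv (1/2) (S (2 * m)) 1.
Proof.
  pose proof (surv_1_binom (2 * m)) as E0.
  pose proof (surv_1_binom (S (2 * m))) as E1.
  pose proof (surv_1_binom (S (S (2 * m)))) as E2.
  replace ((2 * m + 1) / 2)%nat with m in E0
    by (replace (2 * m + 1)%nat with (1 + m * 2)%nat by lia; rewrite Nat.div_add by lia; reflexivity).
  replace ((S (2 * m) + 1) / 2)%nat with (S m) in E1
    by (replace (S (2 * m) + 1)%nat with (0 + S m * 2)%nat by lia; rewrite Nat.div_add by lia; reflexivity).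
  replace ((S (S (2 * m)) + 1) / 2)%nat with (S m) in E2
    by (replace (S (S (2 * m)) + 1)%nat with (1 + S m * 2)%nat by lia; rewrite Nat.div_add by lia; reflexivity).
  destruct (binom_mid m) as [B1 B2].
  apply (f_equal INR) in B1. rewrite B2 in E2.
  rewrite !mult_INR, !plus_INR, mult_INR in B1. rewrite mult_INR in E2.
  change (INR 1) with 1 in *. change (INR 2) with 2 in *.
  rewrite <- E0, <- E1 in B1. rewrite <- E1 in E2.
  rewrite <- !tech_pow_Rmult in *.
  assert (0 < 2 ^ (2 * m)) by (apply pow_lt; lra).
  set (p := 2 ^ (2 * m)) in *. split; apply Rmult_eq_reg_r with p; lra.
Qed.

(** Induction over pairs of times. The odd time [2m + 1] carries the stronger constant [2m + 3],
    because its value is also the value at time [2m + 2]. *)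
Lemma surv_1_sq k : (INR k + 1) * (surv (1/2) k 1 * surv (1/2) k 1) <= 1.
Proof.
  assert (He : forall m, (2 * INR m + 1) * (surv (1/2) (2 * m) 1 * surv (1/2) (2 * m) 1) <= 1 /\
     (2 * INR m + 3) * (surv (1/2) (S (2 * m)) 1 * surv (1/2) (S (2 * m)) 1) <= 1).
  { assert (Hs : forall m, (2 * INR m + 1) * (surv (1/2) (2 * m) 1 * surv (1/2) (2 * m) 1) <= 1 ->
     (2 * INR m + 3) * (surv (1/2) (S (2 * m)) 1 * surv (1/2) (S (2 * m)) 1) <= 1).
    { intros m. destruct (surv_1_even_odd m) as [E _]. pose proof (pos_INR m).
      set (x := surv (1/2) (2 * m) 1) in *. set (y := surv (1/2) (S (2 * m)) 1) in *.
      set (r := INR m) in *. intros Hx.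
      assert (y = (2 * r + 1) * x / (2 * r + 2)) as -> by (rewrite <- E; field; lra).
      apply Rmult_le_reg_r with ((2 * r + 2) * (2 * r + 2)); [nra|].
      replace ((2 * r + 3) * ((2 * r + 1) * x / (2 * r + 2) * ((2 * r + 1) * x / (2 * r + 2))) *
         ((2 * r + 2) * (2 * r + 2))) with
        ((2 * r + 3) * (2 * r + 1) * ((2 * r + 1) * (x * x))) by (field; lra).
      (* What remains after this is [(2r + 3)(2r + 1) <= (2r + 2)^2]. *)
      assert ((2 * r + 3) * (2 * r + 1) * ((2 * r + 1) * (x * x)) <= (2 * r + 3) * (2 * r + 1) * 1).
      { apply Rmult_le_compat_l; nra. }
      nra. }
    induction m as [|m [_ IH]].
    - split; [simpl; lra|]. apply Hs. simpl; lra.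
    - assert (H : (2 * INR (S m) + 1) * (surv (1/2) (2 * S m) 1 * surv (1/2) (2 * S m) 1) <= 1).
      { replace (2 * S m)%nat with (S (S (2 * m))) by lia.
        destruct (surv_1_even_odd m) as [_ ->]. rewrite S_INR. lra. }
      auto. }
  destruct (Nat.Even_or_Odd k) as [[m ->]|[m ->]]; destruct (He m) as [H1 H2].
  - rewrite mult_INR. simpl (INR 2). lra.
  - rewrite Nat.add_1_r, S_INR, mult_INR. simpl (INR 2).
    pose proof (Rle_0_sqr (surv (1/2) (S (2 * m)) 1)) as K. unfold Rsqr in K. lra.
Qed.

Lemma sqrt_surv_1_le s k : 0 <= s ->
  sqrt s * surv (1/2) k 1 <= 1/2 * (s / (INR k + 1) + 1).
Proof.
  intros Hs. pose proof (surv_1_sq k) as H. pose proof (pos_INR k).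
  set (x := surv (1/2) k 1) in *. pose proof (sqrt_sqrt s Hs) as E.
  set (r := sqrt s) in *. set (n := INR k + 1) in *.
  assert (Hn : 0 < n) by (unfold n; lra).
  (* AM-GM: [2 r x <= r^2 / n + n x^2] *)
  assert (2 * (r * x) <= r * r / n + n * (x * x)).
  { apply Rmult_le_reg_r with n; auto.
    replace ((r * r / n + n * (x * x)) * n) with (r * r + (n * x) * (n * x)) by (field; lra).
    pose proof (Rle_0_sqr (r - n * x)). unfold Rsqr in *. lra. }
  rewrite <- E. lra.
Qed.

Lemma poisson_surv_le s n : 0 <= s ->
  sqrt s * poisson s (fun k => surv (1/2) k n) <= INR n.
Proof.
  intros Hs. unfold poisson.
  rewrite <- Rmult_assoc, (Rmult_comm (sqrt s)), Rmult_assoc, <- Series_scal_l.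
  pose proof (is_series_exp s) as H.
  (* Weighting [expo_term s k] by [s / (k + 1)] gives the next term, so the weighted series is the
     exponential series without its first term. The Poisson average is then at most
     [INR n / 2 * (2 - exp (- s))]. *)
  assert (H1 : is_series (fun k => expo_term s (S k)) (exp s - 1)).
  { apply is_series_incr_1. unfold plus; simpl. replace (expo_term s 0) with 1.
    - replace (exp s - 1 + 1) with (exp s) by ring. exact H.
    - unfold expo_term. simpl. field. }
  pose proof (is_series_scal_l (INR n / 2) _ _ (is_series_plus _ _ _ _ H1 H)) as H2.
  apply Rle_trans with (exp (- s) * (INR n / 2 * (exp s - 1 + exp s))).
  - apply Rmult_le_compat_l; [left; apply exp_pos|].
    eapply Rle_trans; [|right; exact (is_series_unique _ _ H2)].
    apply Series_le; [|eexists; exact H2].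
    intros k. unfold scal, plus; simpl. unfold mult; simpl.
    pose proof (expo_term_nonneg k Hs) as He.
    pose proof (@surv_bounds (1/2) k n ltac:(lra)) as Hb.
    split.
    + apply Rmult_le_pos; [apply sqrt_pos|]. apply Rmult_le_pos; tauto.
    + replace (expo_term s (S k)) with (expo_term s k * (s / (INR k + 1))).
      * replace (INR n / 2 * (expo_term s k * (s / (INR k + 1)) + expo_term s k))
          with (expo_term s k * (INR n * (1/2 * (s / (INR k + 1) + 1)))) by (field; pose proof (pos_INR k); lra).
        rewrite <- Rmult_assoc, (Rmult_comm (sqrt s)), Rmult_assoc.
        apply Rmult_le_compat_l; auto.
        apply Rle_trans with (INR n * (sqrt s * surv (1/2) k 1)).
        -- rewrite <- Rmult_assoc, (Rmult_comm (INR n)), Rmult_assoc.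
           apply Rmult_le_compat_l; [apply sqrt_pos|]. apply surv_le_linear; lra.
        -- apply Rmult_le_compat_l; [apply pos_INR|]. apply sqrt_surv_1_le; auto.
      * unfold expo_term. change (fact (S k)) with (S k * fact k)%nat.
        rewrite mult_INR, S_INR. simpl. pose proof (INR_fact_neq_0 k). pose proof (pos_INR k).
        field. split; auto; lra.
  - replace (exp (- s) * (INR n / 2 * (exp s - 1 + exp s)))
      with (INR n / 2 * (2 * (exp (- s) * exp s) - exp (- s))) by field.
    rewrite <- exp_plus, Rplus_opp_l, exp_0. pose proof (exp_pos (- s)). pose proof (pos_INR n).
    nra.
Qed.

(** * The half-line graph and bounds on [phi] *)

Section HalfLine.
Variable qmin : R.
Hypothesis Hqmin : 0 <= qmin.

Definition halfline_nbrs (m : nat) : list nat :=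
  match m with O => nil | S j => [j; S (S j)] end.

Lemma halfline_nbrs_spec m :
  NoDup (halfline_nbrs m) /\ forall y, q0 qmin m y <> 0 -> In y (halfline_nbrs m).
Proof.
  destruct m as [|j]; simpl; split.
  - constructor.
  - intros y H. apply H. reflexivity.
  - repeat constructor; simpl; lia.
  - intros y Hy. apply NNPP. intros Hn. apply Hy. unfold q0.
    replace (S j =? S y)%nat with false by (symmetry; apply Nat.eqb_neq; lia).
    replace (y =? S (S j))%nat with false by (symmetry; apply Nat.eqb_neq; lia).
    rewrite Bool.andb_false_r. reflexivity.
Qed.

Lemma q0_S_l j : q0 qmin (S j) j = 2 * qmin.
Proof. unfold q0. rewrite Nat.eqb_refl. reflexivity. Qed.

Lemma q0_S_r j : q0 qmin (S j) (S (S j)) = 2 * qmin.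
Proof. unfold q0. rewrite (Nat.eqb_refl (S (S j))), Bool.orb_true_r. reflexivity. Qed.

Lemma is_graph_q0 : is_graph (q0 qmin).
Proof.
  split.
  - intros x y. unfold q0. destruct (_ && _)%bool; lra.
  - intros x. exists (halfline_nbrs x). intros y Hy. apply halfline_nbrs_spec. lra.
Qed.

Lemma degree_q0 m : degree (q0 qmin) m <= 4 * qmin.
Proof.
  destruct (halfline_nbrs_spec m) as [N H]. unfold degree. rewrite (fsum_eq _ N H).
  destruct m as [|j]; simpl; [lra|]. rewrite q0_S_l, q0_S_r. lra.
Qed.

Lemma laplacian_q0 g m : laplacian (q0 qmin) g m =
  match m with O => 0 | S j => 2 * qmin * (g j + g (S m) - 2 * g m) end.
Proof.
  destruct (halfline_nbrs_spec m) as [N H]. rewrite (@laplacian_lsum _ _ m (halfline_nbrs m) g N H).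
  destruct m as [|j]; simpl; [lra|]. rewrite q0_S_l, q0_S_r. ring.
Qed.

(** Fixes the jump probability: [2 * qmin / L] is what uniformizing the half-line at rate [L]
    produces. *)
Lemma surv_step L k m : 0 < L ->
  surv (2 * qmin / L) (S k) m =
  surv (2 * qmin / L) k m + laplacian (q0 qmin) (surv (2 * qmin / L) k) m / L.
Proof.
  intros HL. rewrite laplacian_q0. destruct m as [|j].
  - rewrite !surv_0. lra.
  - rewrite surv_S. field. lra.
Qed.

Definition halfline_ball (i m : nat) : Prop := (m < i)%nat.

Lemma exhaustion_halfline : exhaustion halfline_ball.
Proof.
  unfold halfline_ball. split; [|split].
  - intros i. exists (seq 0 i). intros x Hx. apply in_seq. lia.
  - intros; lia.
  - intros x. exists (S x). lia.
Qed.

Notation pos_indic := (indic (fun m : nat => (0 < m)%nat)).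

Lemma surv_init th m : pos_indic m = surv th 0 m.
Proof.
  destruct m as [|m]; simpl.
  - apply indic_notin. lia.
  - apply indic_in. lia.
Qed.

Lemma lazy_prob L : 0 < L -> 4 * qmin <= L -> 0 <= 2 * qmin / L <= 1/2.
Proof.
  intros HL H. split.
  - apply Rdiv_le_0_compat; lra.
  - apply Rmult_le_reg_r with L; auto. unfold Rdiv. rewrite Rmult_assoc, Rinv_l by lra. lra.
Qed.

Lemma unif_iter_surv_le L i k m : 0 < L -> 4 * qmin <= L ->
  unif_iter (q0 qmin) L (halfline_ball i) pos_indic k m <= surv (2 * qmin / L) k m.
Proof.
  intros HL H. apply (@unif_iter_le _ _ is_graph_q0); auto.
  - intros x _. pose proof (degree_q0 x). lra.
  - intros. apply surv_bounds, lazy_prob; auto.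
  - intros x. right. apply surv_init.
  - intros. rewrite surv_step by auto. lra.
Qed.

(** Finite propagation speed: in [k] steps from [m] the walk does not feel a truncation at
    [i > m + k]. *)
Lemma unif_iter_surv_eq L i k : 0 < L -> forall m, (m + k < i)%nat ->
  unif_iter (q0 qmin) L (halfline_ball i) pos_indic k m = surv (2 * qmin / L) k m.
Proof.
  intros HL. induction k as [|k IH]; intros m Hm.
  - unfold unif_iter. simpl Nat.iter. rewrite (indic_in (halfline_ball i)) by (unfold halfline_ball; lia).
    rewrite <- surv_init. ring.
  - rewrite (unif_iter_S is_graph_q0) by (unfold halfline_ball; lia).
    rewrite surv_step, !laplacian_q0, IH by (auto; lia).
    destruct m as [|j]; auto. rewrite !IH by lia. reflexivity.
Qed.

Lemma pos_indic_bounds m : 0 <= pos_indic m <= 1.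
Proof. apply indic_bounds. Qed.

(** The rate [L] stays free, since the comparison must use a rate that also dominates the degrees of
    the coupling. *)
Lemma phi_ge L t n : 0 <= t -> 0 < L -> 4 * qmin <= L ->
  poisson (L * t) (fun k => surv (2 * qmin / L) k n) <= phi qmin t n.
Proof.
  intros Ht HL H. unfold phi.
  pose proof (@heat_cv _ _ is_graph_q0 t pos_indic n Ht pos_indic_bounds _ exhaustion_halfline) as Hcv.
  set (ph := heat _ _ _ _) in *.
  assert (Hd : forall i y, halfline_ball i y -> degree (q0 qmin) y <= L)
    by (intros i y _; pose proof (degree_q0 y); lra).
  assert (Hb : bounded01 (fun k => surv (2 * qmin / L) k n))
    by (intros k; apply surv_bounds, lazy_prob; auto).
  assert (Hs : is_series (fun k => exp (- (L * t)) * (expo_term (L * t) k * surv (2 * qmin / L) k n))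
     (poisson (L * t) (fun k => surv (2 * qmin / L) k n))).
  { apply is_series_poisson; auto. }
  apply is_series_Reals in Hs.
  (* On [halfline_ball (n + i + 1)] the iterates at [n] agree with [surv] for all [k <= i], so the
     [i]-th partial sum of the Poisson series lies below the truncated semigroup. *)
  assert (Hcv' : Un_cv (fun i => PS (q0 qmin) (halfline_ball (n + i + 1)) t pos_indic n) ph).
  { intros eps He. destruct (Hcv eps He) as [N HN]. exists N. intros i Hi. apply HN. lia. }
  eapply Rle_cv_lim; [|exact Hs|exact Hcv'].
  intros i. simpl. rewrite (@PS_poisson _ _ is_graph_q0 L) by eauto using pos_indic_bounds.
  set (u := unif_iter _ _ _ _).
  assert (Hu : bounded01 (fun k => u k n)).
  { intros k. apply (@unif_iter_bounds _ _ is_graph_q0); eauto using pos_indic_bounds. }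
  rewrite (sum_eq _ (fun k => exp (- (L * t)) * (expo_term (L * t) k * u k n))).
  - apply partial_sum_le_series.
    + intros k. apply Rmult_le_pos; [left; apply exp_pos|]. apply Rmult_le_pos; [|apply Hu].
      apply expo_term_nonneg. nra.
    + apply is_series_poisson; auto.
  - intros k Hk. unfold u. rewrite unif_iter_surv_eq by (auto; lia). reflexivity.
Qed.

Lemma phi_le t n : 0 <= t -> 0 < qmin ->
  phi qmin t n <= poisson (4 * qmin * t) (fun k => surv (1/2) k n).
Proof.
  intros Ht Hp. unfold phi.
  apply (@heat_le _ _ is_graph_q0) with (A := halfline_ball); auto using pos_indic_bounds, exhaustion_halfline.
  intros i. assert (HL : 0 < 4 * qmin) by lra.
  assert (Hd : forall y, halfline_ball i y -> degree (q0 qmin) y <= 4 * qmin)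
    by (intros y _; apply degree_q0).
  rewrite (@PS_poisson _ _ is_graph_q0 (4 * qmin)) by auto using pos_indic_bounds.
  replace (1 / 2) with (2 * qmin / (4 * qmin)) by (field; lra).
  apply poisson_le.
  - nra.
  - intros k. split; [|apply unif_iter_surv_le; lra].
    apply (@unif_iter_nonneg _ _ is_graph_q0); auto. intros; apply pos_indic_bounds.
  - intros k. apply surv_bounds, lazy_prob; lra.
Qed.

(** The product form covers [qmin = 0], where the left side vanishes. For positive [qmin],
    uniformization at rate [4 * qmin] gives the simple random walk with [s = 4 * qmin * t]. *)
Lemma phi_sqrt_le t n : 0 <= t -> 2 * sqrt (t * qmin) * phi qmin t n <= INR n.
Proof.
  intros Ht. destruct Hqmin as [Hp|E].
  - replace (2 * sqrt (t * qmin)) with (sqrt (4 * qmin * t)).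
    + eapply Rle_trans; [|apply (@poisson_surv_le (4 * qmin * t)); nra].
      apply Rmult_le_compat_l; [apply sqrt_pos|]. apply phi_le; auto.
    + replace (4 * qmin * t) with ((2 * 2) * (t * qmin)) by ring.
      rewrite sqrt_mult, sqrt_square by nra. reflexivity.
  - rewrite <- E, Rmult_0_r, sqrt_0. pose proof (pos_INR n). lra.
Qed.

End HalfLine.

(** * The graph distance *)

Section Distance.
Variables (V : Type) (q : V -> V -> R).
Hypothesis Hg : is_graph q.
Hypothesis Hrev : reversible q.
Hypothesis Hconn : connected q.

Lemma gdist_spec x y : reach q (gdist q x y) x y /\
  forall m, reach q m x y -> (gdist q x y <= m)%nat.
Proof.
  unfold gdist.
  match goal with |- context [epsilon ?i ?P] => apply (epsilon_spec i P) end.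
  destruct (@dec_inh_nat_subset_has_unique_least_element (fun n => reach q n x y))
    as (n & Hn & _).
  - intros n. apply classic.
  - apply Hconn.
  - exists n. exact Hn.
Qed.

Lemma reach_trans n x y : reach q n x y ->
  forall m z, reach q m y z -> reach q (n + m) x z.
Proof. induction 1; intros m z' Hz; simpl; auto. econstructor; eauto. Qed.

Lemma rate_pos_sym x y : q x y > 0 -> q y x > 0.
Proof.
  destruct Hrev as (m & Hm & E). intros H. specialize (E x y).
  pose proof (Hm x). pose proof (Hm y). destruct Hg as [Hpos _]. specialize (Hpos y x).
  destruct Hpos as [?|Z]; auto. rewrite <- Z in E. nra.
Qed.

Lemma reach_sym n x y : reach q n x y -> reach q n y x.
Proof.
  induction 1 as [|n x y z Hxy Hyz IH]; [constructor|].
  rewrite <- Nat.add_1_r. eapply reach_trans; eauto.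
  econstructor; [apply rate_pos_sym; eauto|constructor].
Qed.

Lemma gdist_sym x y : gdist q x y = gdist q y x.
Proof. apply Nat.le_antisymm; apply gdist_spec, reach_sym, gdist_spec. Qed.

Lemma gdist_triangle x y z : (gdist q x z <= gdist q x y + gdist q y z)%nat.
Proof. apply gdist_spec. eapply reach_trans; apply gdist_spec. Qed.

Lemma gdist_refl x : gdist q x x = 0%nat.
Proof. apply Nat.le_0_r. apply gdist_spec. constructor. Qed.

Lemma gdist_eq0 x y : gdist q x y = 0%nat -> x = y.
Proof.
  intros E. destruct (gdist_spec x y) as [H _]. rewrite E in H. inversion H; auto.
Qed.

Definition rdist (x y : V) : R := INR (gdist q x y).

Lemma rdist_sym x y : rdist x y = rdist y x.
Proof. unfold rdist. rewrite gdist_sym. auto. Qed.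

Lemma rdist_triangle x y z : rdist x z <= rdist x y + rdist y z.
Proof. unfold rdist. rewrite <- plus_INR. apply le_INR, gdist_triangle. Qed.

Lemma rdist_refl x : rdist x x = 0.
Proof. unfold rdist. rewrite gdist_refl. auto. Qed.

Lemma rdist_pos x y : x <> y -> 0 < rdist x y.
Proof.
  intros H. apply (lt_INR 0). destruct (gdist q x y) eqn:E; [|lia].
  destruct H. apply gdist_eq0; auto.
Qed.

(** * Kantorovich potentials of optimal plans *)

Lemma lsum_app (T : Type) (F : T -> R) l l' : lsum F (l ++ l') = lsum F l + lsum F l'.
Proof. induction l as [|a l IH]; simpl; lra. Qed.

Lemma lsum_map (T U : Type) (F : U -> R) (h : T -> U) l :
  lsum F (map h l) = lsum (fun x => F (h x)) l.
Proof. induction l as [|a l IH]; simpl; lra. Qed.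

Lemma lsum_list_prod (F : V * V -> R) l l' :
  lsum F (list_prod l l') = lsum (fun x => lsum (fun y => F (x, y)) l') l.
Proof.
  induction l as [|a l IH]; simpl; auto. rewrite lsum_app, lsum_map, IH. auto.
Qed.

Lemma NoDup_list_prod (T U : Type) (l : list T) (l' : list U) :
  NoDup l -> NoDup l' -> NoDup (list_prod l l').
Proof.
  intros N N'. induction N as [|a l Ha N IH]; simpl; [constructor|].
  apply NoDup_app; auto.
  - apply FinFun.Injective_map_NoDup; auto. intros u v E. congruence.
  - intros p Hp Hp'. apply in_map_iff in Hp. destruct Hp as (u & <- & _).
    apply in_prod_iff in Hp'. tauto.
Qed.

(** Provides a step size small enough that perturbing [r] in direction [E] keeps it non-negative
    wherever it was positive. *)
Lemma small_factor (T : Type) (r E : T -> R) (l : list T) :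
  exists eps, 0 < eps /\ forall p, In p l -> 0 < r p -> eps * Rabs (E p) <= r p.
Proof.
  induction l as [|a l (eps & He & H)].
  - exists 1. split; [lra|]. simpl; tauto.
  - destruct (Rlt_dec 0 (r a)) as [Ha|Ha].
    + set (e := r a / (1 + Rabs (E a))). pose proof (Rabs_pos (E a)).
      assert (Hpe : 0 < e) by (apply Rdiv_lt_0_compat; lra).
      exists (Rmin eps e). split; [apply Rmin_pos; auto|].
      pose proof (Rmin_l eps e). pose proof (Rmin_r eps e).
      intros p [<-|Hp] Hr.
      * apply Rle_trans with (e * (1 + Rabs (E a))); [nra|].
        unfold e. right. field. lra.
      * pose proof (H p Hp Hr). pose proof (Rabs_pos (E p)). nra.
    + exists eps. split; auto. intros p [<-|Hp] Hr; auto. tauto.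
Qed.

Section Plan.
Variables (x0 y0 : V) (rho : V * V -> R) (L : list V).
Hypothesis Hopt : optimal_plan q x0 y0 rho.
Hypothesis HL : NoDup L.
Hypothesis HLx : In x0 L.
Hypothesis HLy : In y0 L.
Hypothesis Hsupp : forall p, rho p <> 0 -> In p (list_prod L L).

Let NLL : NoDup (list_prod L L).
Proof. apply NoDup_list_prod; auto. Qed.

Lemma lsum_indic_row (x w x' : V) : In w L ->
  lsum (fun y => indic (eq (x, w)) (x', y)) L = indic (eq x) x'.
Proof.
  intros Hw. destruct (classic (x = x')) as [<-|N].
  - rewrite (indic_in (eq x)) by auto.
    rewrite <- (lsum_indic_eq _ (fun _ => 1) HL Hw). apply lsum_ext. intros y _.
    rewrite Rmult_1_r. destruct (classic (w = y)) as [<-|N].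
    + rewrite !indic_in; auto.
    + rewrite !indic_notin; congruence.
  - rewrite (indic_notin (eq x)) by auto. apply lsum_zero. intros y _.
    apply indic_notin. congruence.
Qed.

Lemma lsum_indic_col (x w y' : V) : In x L ->
  lsum (fun x' => indic (eq (x, w)) (x', y')) L = indic (eq w) y'.
Proof.
  intros Hw. destruct (classic (w = y')) as [<-|N].
  - rewrite (indic_in (eq w)) by auto.
    rewrite <- (lsum_indic_eq _ (fun _ => 1) HL Hw). apply lsum_ext. intros y _.
    rewrite Rmult_1_r. destruct (classic (x = y)) as [<-|N].
    + rewrite !indic_in; auto.
    + rewrite !indic_notin; congruence.
  - rewrite (indic_notin (eq w)) by auto. apply lsum_zero. intros y _.
    apply indic_notin. congruence.
Qed.

Let dp (p : V * V) : R := rdist (fst p) (snd p).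

Lemma plan_nonneg p : 0 <= rho p.
Proof. apply Hopt. Qed.

(** First-order optimality: if [E] lowered the total distance, adding a small multiple of it to
    [rho] would give a plan of larger cost. *)
Lemma optimal_variation (E : V * V -> R) :
  (forall p, E p <> 0 -> In p (list_prod L L)) ->
  (forall p, rho p = 0 -> p <> (x0, y0) -> 0 <= E p) ->
  (forall x, lsum (fun y => E (x, y)) L = 0) ->
  (forall y, lsum (fun x => E (x, y)) L = 0) ->
  0 <= lsum (fun p => E p * dp p) (list_prod L L).
Proof.
  intros Hs Hp Hr Hc. destruct Hopt as ((_ & Trow & Tcol) & Hmax).
  destruct (small_factor rho E (list_prod L L)) as (eps & He & Hsm).
  (* mass at [(x0, y0)] is unconstrained and free of cost *)
  set (M := eps * Rabs (E (x0, y0))).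
  set (rho' := fun p => rho p + (eps * E p + M * indic (eq (x0, y0)) p)).
  assert (HM : 0 <= M) by (apply Rmult_le_pos; [lra|apply Rabs_pos]).
  assert (Hin0 : In (x0, y0) (list_prod L L)) by (apply in_prod; auto).
  assert (Hsupp' : forall p, rho' p <> 0 -> In p (list_prod L L)).
  { intros p H. apply NNPP. intros Hn. apply H. unfold rho'.
    replace (rho p) with 0 by (symmetry; apply NNPP; auto).
    replace (E p) with 0 by (symmetry; apply NNPP; auto).
    rewrite indic_notin by congruence. ring. }
  assert (Hpos' : forall p, 0 <= rho' p).
  { intros p. unfold rho'. pose proof (plan_nonneg p). pose proof (indic_bounds (eq (x0, y0)) p).
    destruct (classic (p = (x0, y0))) as [->|N].
    - rewrite indic_in by auto. unfold M. pose proof (Rle_abs (- E (x0, y0))) as K.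
      rewrite Rabs_Ropp in K. nra.
    - rewrite indic_notin by auto. destruct (Req_dec (rho p) 0) as [Z|Z].
      + specialize (Hp p Z N). nra.
      + specialize (Hsm p (Hsupp Z) ltac:(lra)). pose proof (Rle_abs (- E p)) as K.
        rewrite Rabs_Ropp in K. nra. }
  assert (T' : transport_plan q x0 y0 rho').
  { split; [|split]; auto.
    - intros x Hx.
      assert (E1 : lsum (fun y => rho (x, y)) L = q x0 x).
      { eapply is_lub_u; [|apply (Trow x Hx)]. apply has_sum_lsum; auto.
        - intros; apply plan_nonneg.
        - intros y Hy. apply Hsupp, in_prod_iff in Hy. tauto. }
      replace (q x0 x) with (lsum (fun y => rho' (x, y)) L).
      + apply has_sum_lsum; auto. intros y Hy. apply Hsupp', in_prod_iff in Hy. tauto.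
      + unfold rho'. rewrite !lsum_plus, !lsum_scal, E1, Hr, lsum_indic_row by auto.
        rewrite indic_notin by auto. ring.
    - intros y Hy.
      assert (E1 : lsum (fun x => rho (x, y)) L = q y0 y).
      { eapply is_lub_u; [|apply (Tcol y Hy)]. apply has_sum_lsum; auto.
        - intros; apply plan_nonneg.
        - intros x Hx. apply Hsupp, in_prod_iff in Hx. tauto. }
      replace (q y0 y) with (lsum (fun x => rho' (x, y)) L).
      + apply has_sum_lsum; auto. intros x Hx. apply Hsupp', in_prod_iff in Hx. tauto.
      + unfold rho'. rewrite !lsum_plus, !lsum_scal, E1, Hc, lsum_indic_col by auto.
        rewrite indic_notin by auto. ring. }
  assert (Hcost : forall r : V * V -> R, (forall p, r p <> 0 -> In p (list_prod L L)) ->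
    cost q x0 y0 r = lsum (fun p => r p * (rdist x0 y0 - dp p)) (list_prod L L)).
  { intros r Hr'. apply fsum_eq; auto. intros p H. apply Hr'. intros Z. apply H.
    rewrite Z. ring. }
  specialize (Hmax _ T'). rewrite !Hcost in Hmax by auto.
  assert (K : lsum (fun p => rho' p * (rdist x0 y0 - dp p)) (list_prod L L) =
     lsum (fun p => rho p * (rdist x0 y0 - dp p)) (list_prod L L)
     + (eps * rdist x0 y0 * lsum E (list_prod L L) + (- eps * lsum (fun p => E p * dp p) (list_prod L L)
     + M * lsum (fun p => indic (eq (x0, y0)) p * (rdist x0 y0 - dp p)) (list_prod L L)))).
  { rewrite <- !lsum_scal, <- !lsum_plus. apply lsum_ext. intros p _. unfold rho'. ring. }
  (* Both correction terms vanish: [E] has total mass zero, and pairs at distance [rdist x0 y0]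
     contribute no cost. *)
  rewrite K, lsum_indic_eq in Hmax by auto.
  change (dp (x0, y0)) with (rdist x0 y0) in Hmax.
  replace (lsum E (list_prod L L)) with 0 in Hmax.
  - assert (0 <= eps * lsum (fun p => E p * dp p) (list_prod L L)) by lra.
    apply Rmult_le_reg_l with eps; lra.
  - rewrite lsum_list_prod. symmetry. apply lsum_zero. auto.
Qed.

(** Pairs from which mass may be removed. The pair [(x0, y0)] always qualifies, because its mass is
    unconstrained. *)
Definition active (p : V * V) : Prop := 0 < rho p \/ p = (x0, y0).

Lemma active_in p : active p -> In p (list_prod L L).
Proof.
  intros [H| ->].
  - apply Hsupp. lra.
  - apply in_prod; auto.
Qed.

(* [chain w v D]: alternating walks from [y0] to [w] which follow active pairs [(x, y)]
   from [x] to [y] (gaining [d x y]) and jump freely in between (paying the distance); [v] is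
   the balance and [D] records the rerouting of mass from the pairs to the jumps. *)
Inductive chain : V -> R -> (V * V -> R) -> Prop :=
| chain_nil : chain y0 0 (fun _ => 0)
| chain_step w v D x y : chain w v D -> active (x, y) ->
    chain y (v - rdist x w + rdist x y)
      (fun p => D p + (indic (eq (x, w)) p + -1 * indic (eq (x, y)) p)).

(** Each step exchanges [(x, y)] for [(x, w)] within one row, so row sums stay zero and the column
    sums telescope from [y0] to the endpoint. *)
Lemma chain_inv w v D : chain w v D ->
  In w L /\
  (forall p, D p <> 0 -> In p (list_prod L L)) /\
  (forall p, rho p = 0 -> p <> (x0, y0) -> 0 <= D p) /\
  (forall x, lsum (fun y => D (x, y)) L = 0) /\
  (forall y, lsum (fun x => D (x, y)) L = indic (eq y0) y - indic (eq w) y) /\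
  lsum (fun p => D p * dp p) (list_prod L L) = - v.
Proof.
  induction 1 as [|w v D x y _ (H1 & H2 & H3 & H4 & H5 & H6) Ha].
  - split; [auto|]. split; [tauto|]. split; [intros; lra|].
    split; [intros; apply lsum_zero; auto|].
    split; [intros; rewrite lsum_zero by auto; ring|].
    rewrite lsum_zero; [ring|]. intros; ring.
  - pose proof (active_in Ha) as Hin. assert (In x L /\ In y L) as [Hx Hy]
      by (apply in_prod_iff in Hin; auto).
    assert (Hin' : In (x, w) (list_prod L L)) by (apply in_prod; auto).
    split; [auto|]. split; [|split; [|split; [|split]]].
    + intros p Hp. apply NNPP. intros Hn. apply Hp.
      replace (D p) with 0 by (symmetry; apply NNPP; auto).
      rewrite !indic_notin by congruence. ring.
    + intros p Hz N. specialize (H3 p Hz N).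
      rewrite (@indic_notin _ (eq (x, y))).
      * pose proof (indic_bounds (eq (x, w)) p). lra.
      * intros <-. destruct Ha as [Ha|Ha]; [lra|]. congruence.
    + intros x'. rewrite !lsum_plus, lsum_scal, !lsum_indic_row, H4 by auto. ring.
    + intros y'. rewrite !lsum_plus, lsum_scal, !lsum_indic_col, H5 by auto. ring.
    + rewrite (lsum_ext _ (fun p => D p * dp p +
        (indic (eq (x, w)) p * dp p + -1 * (indic (eq (x, y)) p * dp p)))) by (intros; ring).
      rewrite !lsum_plus, lsum_scal, !lsum_indic_eq, H6 by auto. unfold dp. simpl. ring.
Qed.

(** Closing the chain through [(x0, w)] and the active pair [(x0, y0)] makes all marginals of the
    rerouting zero, so [optimal_variation] applies; this is cyclical monotonicity. *)
Lemma chain_bound w v D : chain w v D -> v <= rdist x0 w - rdist x0 y0.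
Proof.
  intros Hch. destruct (chain_inv Hch) as (H1 & H2 & H3 & H4 & H5 & H6).
  assert (Hin0 : In (x0, y0) (list_prod L L)) by (apply in_prod; auto).
  assert (Hinw : In (x0, w) (list_prod L L)) by (apply in_prod; auto).
  set (E := fun p => D p + (indic (eq (x0, w)) p + -1 * indic (eq (x0, y0)) p)).
  assert (0 <= lsum (fun p => E p * dp p) (list_prod L L)) as K.
  { apply optimal_variation; unfold E.
    - intros p Hp. apply NNPP. intros Hn. apply Hp.
      replace (D p) with 0 by (symmetry; apply NNPP; auto).
      rewrite !indic_notin by congruence. ring.
    - intros p Hz N. specialize (H3 p Hz N). rewrite (@indic_notin _ (eq (x0, y0))) by auto.
      pose proof (indic_bounds (eq (x0, w)) p). lra.
    - intros x'. rewrite !lsum_plus, lsum_scal, !lsum_indic_row, H4 by auto. ring.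
    - intros y'. rewrite !lsum_plus, lsum_scal, !lsum_indic_col, H5 by auto. ring. }
  unfold E in K. rewrite (lsum_ext _ (fun p => D p * dp p +
    (indic (eq (x0, w)) p * dp p + -1 * (indic (eq (x0, y0)) p * dp p)))) in K by (intros; ring).
  rewrite !lsum_plus, lsum_scal, !lsum_indic_eq, H6 in K by auto. unfold dp in K. simpl in K. lra.
Qed.

Lemma kantorovich_potential : exists f : V -> R,
  (forall u v, f u - f v <= rdist u v) /\ f y0 - f x0 = rdist x0 y0 /\
  forall x y, rho (x, y) <> 0 -> f y - f x = rdist x y.
Proof.
  (* The potential at [z] is the supremum of [v - rdist w z] over chains ending at [w], finite by
     [chain_bound]. It is 1-Lipschitz as a supremum of such functions, and appending an active pair
     to a chain gives equality on that pair. *)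
  set (S z := fun r => exists w v D, chain w v D /\ r = v - rdist w z).
  assert (Hlub : forall z, { m | is_lub (S z) m }).
  { intros z. apply completeness.
    - exists (rdist x0 z - rdist x0 y0). intros r (w & v & D & Hc & ->).
      pose proof (chain_bound Hc). pose proof (rdist_triangle x0 z w).
      rewrite (rdist_sym w z). lra.
    - exists (0 - rdist y0 z), y0, 0, (fun _ => 0). split; auto. constructor. }
  set (f z := proj1_sig (Hlub z)).
  assert (Hf : forall z, is_lub (S z) (f z)) by (intros z; apply (proj2_sig (Hlub z))).
  assert (Hlip : forall u v, f u - f v <= rdist u v).
  { intros u z. assert (f u <= f z + rdist u z); [|lra].
    apply (Hf u). intros r (w & v & D & Hc & ->).
    assert (v - rdist w z <= f z) by (apply (Hf z); exists w, v, D; auto).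
    pose proof (rdist_triangle w u z). lra. }
  assert (Hact : forall x y, active (x, y) -> f y - f x = rdist x y).
  { intros x y Ha. apply Rle_antisym; [rewrite rdist_sym; auto|].
    assert (f x <= f y - rdist x y); [|lra].
    apply (Hf x). intros r (w & v & D & Hc & ->).
    assert (v - rdist x w + rdist x y - rdist y y <= f y).
    { apply (Hf y). do 3 eexists. split; [eapply chain_step; eauto|]. reflexivity. }
    rewrite rdist_refl in *. rewrite (rdist_sym w x). lra. }
  exists f. split; [auto|]. split.
  - apply Hact. right. auto.
  - intros x y Hxy. apply Hact. left. pose proof (plan_nonneg (x, y)). lra.
Qed.

End Plan.

Lemma support_square (rho : V * V -> R) x0 y0 l : (forall p, rho p <> 0 -> In p l) ->
  exists L, NoDup L /\ In x0 L /\ In y0 L /\ forall p, rho p <> 0 -> In p (list_prod L L).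
Proof.
  intros H. destruct (list_nodup (x0 :: y0 :: map fst l ++ map snd l)) as (L & N & E).
  exists L. split; auto. split; [apply E; simpl; auto|]. split; [apply E; simpl; auto|].
  intros [x y] Hp. specialize (H _ Hp). apply in_prod; apply E; simpl; rewrite in_app_iff.
  - right; right; left. apply (in_map fst) in H. exact H.
  - right; right; right. apply (in_map snd) in H. exact H.
Qed.

(** * Perfect couplings *)

Section PerfectCoupling.
Variables (qmin : R) (qt : V * V -> V * V -> R).
Hypothesis Hcurv : nonneg_ollivier q.
Hypothesis Hperf : perfect_coupling q qmin qt.

Let Hqt : is_graph qt.
Proof. apply Hperf. Qed.

Lemma cost_lsum x0 y0 l : NoDup l -> (forall p, qt (x0, y0) p <> 0 -> In p l) ->
  cost q x0 y0 (qt (x0, y0)) =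
  lsum (fun p => qt (x0, y0) p * (rdist x0 y0 - rdist (fst p) (snd p))) l.
Proof.
  intros N H. apply fsum_eq; auto. intros p Hp. apply H. intros Z. apply Hp.
  rewrite Z. ring.
Qed.

Lemma grad_sup_1 f x0 y0 : x0 <> y0 -> (forall u v, f u - f v <= rdist u v) ->
  f y0 - f x0 = rdist x0 y0 -> grad q y0 x0 f = 1 /\ grad_sup_eq q f 1.
Proof.
  intros N Hlip E.
  assert (H1 : grad q y0 x0 f = 1).
  { unfold grad. fold (rdist y0 x0). rewrite E, (rdist_sym y0 x0).
    pose proof (rdist_pos N). field. lra. }
  split; auto. split.
  - intros r (u & v & Nuv & ->). unfold grad. fold (rdist u v).
    pose proof (rdist_pos Nuv). unfold Rdiv. rewrite Rabs_mult, (Rabs_pos_eq (/ _))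
      by (left; apply Rinv_0_lt_compat; auto).
    apply Rmult_le_reg_r with (rdist u v); auto.
    rewrite Rmult_assoc, Rinv_l, Rmult_1_r, Rmult_1_l by lra.
    apply Rabs_le. pose proof (Hlip u v). pose proof (Hlip v u).
    rewrite (rdist_sym v u) in *. lra.
  - intros b Hb. apply Hb. exists y0, x0. split; auto. rewrite H1, Rabs_R1. auto.
Qed.

(** Curvature is tested on the potential [f]. The marginal identities of the coupling express
    [laplacian q f x0 - laplacian q f y0] as a sum against the plan, and equality of [f] on the
    support makes that sum the cost. *)
Lemma optimal_cost_nonneg x0 y0 : x0 <> y0 -> 0 <= cost q x0 y0 (qt (x0, y0)).
Proof.
  intros N. destruct Hperf as ((_ & Hc1 & Hc2) & Hp). destruct (Hp x0 y0) as (Hopt & _).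
  destruct (neighbours Hqt (x0, y0)) as (l & Nl & Hl).
  destruct (support_square (qt (x0, y0)) x0 y0 l Hl) as (L & NL & Hx & Hy & Hs).
  destruct (kantorovich_potential Hopt NL Hx Hy Hs) as (f & Hlip & E0 & Hsat).
  destruct (grad_sup_1 f N Hlip E0) as [H1 Hsup].
  pose proof (@Hcurv x0 y0 N f Hsup H1) as K. unfold grad in K. fold (rdist x0 y0) in K.
  pose proof (rdist_pos N) as Hd.
  assert (0 <= laplacian q f x0 - laplacian q f y0) as K'.
  { apply Rmult_le_reg_r with (/ rdist x0 y0); [apply Rinv_0_lt_compat; auto|]. lra. }
  rewrite <- (Hc1 f x0 y0), <- (Hc2 f x0 y0) in K'.
  rewrite !(fun g => @laplacian_lsum _ qt (x0, y0) l g Nl Hl) in K'.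
  rewrite (@cost_lsum x0 y0 l Nl Hl). simpl in K'.
  replace (lsum (fun p => qt (x0, y0) p * (rdist x0 y0 - rdist (fst p) (snd p))) l)
    with (lsum (fun y => qt (x0, y0) y * (f (fst y) - f x0)) l -
          lsum (fun y => qt (x0, y0) y * (f (snd y) - f y0)) l); auto.
  replace (lsum (fun y => qt (x0, y0) y * (f (snd y) - f y0)) l)
    with (- lsum (fun y => -1 * (qt (x0, y0) y * (f (snd y) - f y0))) l)
    by (rewrite lsum_scal; ring).
  unfold Rminus at 1. rewrite Ropp_involutive, <- lsum_plus. apply lsum_ext.
  intros [x y] _. simpl. destruct (Req_dec (qt (x0, y0) (x, y)) 0) as [Z|Z].
  - rewrite Z. ring.
  - rewrite <- E0, <- (Hsat _ _ Z). ring.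
Qed.

(* The identity plan has cost [0], so an optimal plan from [x0] to itself cannot leave the
   diagonal. *)
Lemma diagonal_absorbing x0 x y : qt (x0, x0) (x, y) <> 0 -> x = y.
Proof.
  intros Hxy. destruct Hperf as (_ & Hp). destruct (Hp x0 x0) as (((Hnn & _) & Hmax) & _).
  destruct (neighbours Hqt (x0, x0)) as (l' & Nl' & Hl').
  set (idp := fun p : V * V => if excluded_middle_informative (fst p = snd p)
    then q x0 (fst p) else 0).
  assert (Hid1 : forall z, idp (z, z) = q x0 z).
  { intros z. unfold idp. simpl. destruct excluded_middle_informative; tauto. }
  assert (Hid0 : forall u v, u <> v -> idp (u, v) = 0).
  { intros u v H. unfold idp. simpl. destruct excluded_middle_informative; tauto. }
  assert (Hidn : forall p, 0 <= idp p).
  { intros [u v]. destruct (classic (u = v)) as [<-|N].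
    - rewrite Hid1. apply Hg.
    - rewrite Hid0 by auto. lra. }
  assert (T : transport_plan q x0 x0 idp).
  { split; [auto|]. split; intros z _.
    - rewrite <- Hid1. replace (idp (z, z)) with (lsum (fun y => idp (z, y)) [z]) by (simpl; ring).
      apply has_sum_lsum; auto.
      + repeat constructor. simpl; tauto.
      + intros y' H. left. apply NNPP. intros N. apply H, Hid0. auto.
    - rewrite <- Hid1. replace (idp (z, z)) with (lsum (fun x => idp (x, z)) [z]) by (simpl; ring).
      apply has_sum_lsum; auto.
      + repeat constructor. simpl; tauto.
      + intros y' H. left. apply NNPP. intros N. apply H, Hid0. auto. }
  specialize (Hmax _ T). rewrite (@cost_lsum x0 x0 l' Nl' Hl') in Hmax.
  assert (C0 : cost q x0 x0 idp = 0).
  { unfold cost. rewrite (@fsum_eq _ _ nil); [reflexivity|constructor|].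
    intros [u v] H. exfalso. apply H. simpl. destruct (classic (u = v)) as [<-|N].
    - rewrite !gdist_refl. ring.
    - rewrite Hid0 by auto. ring. }
  rewrite C0, rdist_refl in Hmax.
  assert (Z : lsum (fun p => qt (x0, x0) p * rdist (fst p) (snd p)) l' = 0).
  { apply Rle_antisym.
    - replace (lsum (fun p => qt (x0, x0) p * rdist (fst p) (snd p)) l')
        with (- lsum (fun p => qt (x0, x0) p * (0 - rdist (fst p) (snd p))) l').
      + lra.
      + rewrite <- (Rmult_1_l (lsum _ _)), <- Ropp_mult_distr_l_reverse, <- lsum_scal.
        apply lsum_ext. intros; ring.
    - apply lsum_nonneg. intros p _. apply Rmult_le_pos; auto. apply pos_INR. }
  pose proof (fun H => lsum_nonneg_eq0 _ _ H Z _ (Hl' _ Hxy)) as K. simpl in K.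
  apply gdist_eq0, INR_eq. change (rdist x y = 0).
  destruct (Rmult_integral _ _ (K ltac:(intros p _; apply Rmult_le_pos; [auto|apply pos_INR])));
    tauto.
Qed.

(* Jumps change the distance by at most one, and those that decrease it are at least as
   frequent as those that increase it, because the optimal cost is non-negative. *)
Lemma laplacian_dist_le (h : nat -> R) x0 y0 n : gdist q x0 y0 = S n ->
  h (S n) <= h (S (S n)) -> h n + h (S (S n)) - 2 * h (S n) <= 0 ->
  laplacian qt (fun p => h (gdist q (fst p) (snd p))) (x0, y0) <=
  2 * qmin * (h n + h (S (S n)) - 2 * h (S n)).
Proof.
  intros Hd Hinc Hconc.
  assert (N : x0 <> y0) by (intros ->; rewrite gdist_refl in Hd; lia).
  pose proof (optimal_cost_nonneg N) as Hcost.
  destruct Hperf as (_ & Hp). destruct (Hp x0 y0) as (((Hnn & _) & _) & Hjump & Hmu).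
  specialize (Hmu N).
  destruct (neighbours Hqt (x0, y0)) as (l & Nl & Hl).
  set (rho := qt (x0, y0)) in *.
  set (d := fun p : V * V => gdist q (fst p) (snd p)).
  set (R_ := fun (k : Z) (p : V * V) =>
     if Z.eq_dec (Z.of_nat (d p) - Z.of_nat (gdist q x0 y0)) k then rho p else 0).
  assert (Emu : forall k, mu q x0 y0 rho k = lsum (R_ k) l).
  { intros k. apply fsum_eq; auto. intros p H. apply Hl. intros Z. apply H.
    destruct Z.eq_dec; auto. }
  assert (Hbd : forall p, rho p <> 0 -> d p = n \/ d p = S n \/ d p = S (S n)).
  { intros p Hr. apply NNPP. intros Hno.
    set (k := (Z.of_nat (d p) - Z.of_nat (gdist q x0 y0))%Z).
    assert (Hk : (Z.abs k > 1)%Z) by (unfold k; lia).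
    specialize (Hjump k Hk). rewrite Emu in Hjump.
    assert (R_ k p = 0) as Z.
    { apply (lsum_nonneg_eq0 (R_ k) l); auto. intros z _. unfold R_.
      destruct Z.eq_dec; [apply Hnn|lra]. }
    unfold R_ in Z. destruct Z.eq_dec; [tauto|]. unfold k in *. tauto. }
  (* Used twice: with [g = h] for the Laplacian, and with [g m = - INR m] for the cost. *)
  assert (Hsplit : forall g : nat -> R, lsum (fun p => rho p * (g (d p) - g (S n))) l =
     (g n - g (S n)) * lsum (R_ (-1)%Z) l + (g (S (S n)) - g (S n)) * lsum (R_ 1%Z) l).
  { intros g. rewrite <- !lsum_scal, <- lsum_plus. apply lsum_ext. intros p _.
    destruct (Req_dec (rho p) 0) as [Z|Z].
    - unfold R_. rewrite Z. destruct Z.eq_dec, Z.eq_dec; ring.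
    - unfold R_. rewrite Hd. destruct (Hbd p Z) as [E|[E|E]]; rewrite E;
        destruct Z.eq_dec, Z.eq_dec; try lia; ring. }
  rewrite (laplacian_lsum _ _ _ Nl Hl).
  rewrite (lsum_ext _ (fun p => rho p * (h (d p) - h (S n))))
    by (intros p _; simpl; rewrite Hd; reflexivity).
  rewrite (Hsplit h).
  unfold rho in Hcost. rewrite (@cost_lsum x0 y0 l Nl Hl) in Hcost. fold rho in Hcost.
  assert (E : lsum (fun p => rho p * (rdist x0 y0 - rdist (fst p) (snd p))) l =
    lsum (R_ (-1)%Z) l - lsum (R_ 1%Z) l).
  { rewrite (lsum_ext _ (fun p => rho p * ((fun m => - INR m) (d p) - (fun m => - INR m) (S n)))).
    - rewrite (Hsplit (fun m => - INR m)). rewrite !S_INR. ring.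
    - intros p _. unfold rdist. rewrite Hd. unfold d. ring. }
  rewrite E in Hcost. rewrite Emu in Hmu.
  (* With [b <= a] and a non-negative last increment, the sum is at most [a] times the second
     difference of [h]; that difference is non-positive and [a >= 2 * qmin]. *)
  set (a := lsum (R_ (-1)%Z) l) in *. set (b := lsum (R_ 1%Z) l) in *. nra.
Qed.

(** The supersolution property of [surv] composed with the distance. On the diagonal it follows from
    absorption, elsewhere from monotonicity and concavity of [surv]. *)
Lemma coupling_step_le L k p : 0 <= qmin -> 0 < L -> 4 * qmin <= L ->
  let w k := fun p => surv (2 * qmin / L) k (gdist q (fst p) (snd p)) in
  w k p + laplacian qt (w k) p / L <= w (S k) p.
Proof.
  intros Hq0 HL H4 w. pose proof (lazy_prob Hq0 HL H4) as Hth. destruct p as [x y].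
  unfold w at 1 3. simpl fst. simpl snd. destruct (gdist q x y) as [|n] eqn:E.
  - rewrite !surv_0. pose proof (gdist_eq0 _ _ E) as <-.
    destruct (neighbours Hqt (x, x)) as (l & N & H).
    rewrite (laplacian_lsum _ _ _ N H). rewrite lsum_zero; [lra|].
    intros [u v] _. unfold w. simpl. rewrite gdist_refl.
    destruct (Req_dec (qt (x, x) (u, v)) 0) as [Z|Z]; [rewrite Z; ring|].
    rewrite <- (diagonal_absorbing Z), gdist_refl. ring.
  - rewrite surv_S.
    pose proof (@laplacian_dist_le (surv (2 * qmin / L) k) x y n E) as K. fold (w k) in K.
    pose proof (@surv_incr_nonneg (2 * qmin / L) k (S n) Hth) as I1.
    pose proof (@surv_incr_decr (2 * qmin / L) k n Hth) as I2. unfold surv_incr in *.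
    specialize (K ltac:(lra) ltac:(lra)).
    apply Rplus_le_compat_l.
    apply Rmult_le_reg_r with L; auto. unfold Rdiv at 1. rewrite Rmult_assoc, Rinv_l by lra.
    eapply Rle_trans; [rewrite Rmult_1_r; exact K|]. right. field. lra.
Qed.

Lemma PS_offdiag_le (A : V * V -> Prop) t x y : 0 <= qmin -> 0 <= t -> finite_set A ->
  PS qt A t (indic (@offdiag V)) (x, y) <= phi qmin t (gdist q x y).
Proof.
  intros Hq0 Ht HA. destruct (degree_bound qt (4 * qmin) HA) as (L & HL & H4 & Hd).
  assert (Hf : forall p, 0 <= indic (@offdiag V) p <= 1) by (intros; apply indic_bounds).
  rewrite (@PS_poisson _ _ Hqt L) by auto.
  eapply Rle_trans; [|apply (phi_ge Hq0 (L := L)); auto].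
  apply poisson_le.
  - nra.
  - intros k. split; [apply (@unif_iter_nonneg _ _ Hqt); auto; apply Hf|].
    apply (@unif_iter_le _ _ Hqt L A (indic (@offdiag V))
      (fun k p => surv (2 * qmin / L) k (gdist q (fst p) (snd p)))); auto.
    + intros. apply surv_bounds, lazy_prob; auto.
    + intros [u v]. simpl. destruct (gdist q u v) eqn:E.
      * right. apply indic_notin. intros N. apply N. apply gdist_eq0. auto.
      * apply Hf.
    + intros. apply coupling_step_le; auto.
  - intros k. apply surv_bounds, lazy_prob; auto.
Qed.

End PerfectCoupling.
End Distance.

(** * Exhaustion of [V * V] and conclusion *)

Lemma countable_square_exhaustion (V : Type) : countable_type V ->
  exists A : nat -> V * V -> Prop, exhaustion A.
Proof.
  intros [c Hc].
  assert (Hfin : forall i, exists l, forall x, (c x <= i)%nat -> In x l).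
  { assert (H1 : forall i, exists l, forall x, c x = i -> In x l).
    { intros i. destruct (classic (exists x, c x = i)) as [[x Hx]|N].
      - exists [x]. intros y Hy. left. apply Hc. congruence.
      - exists []. intros x Hx. destruct N. eauto. }
    induction i as [|i [l Hl]].
    - destruct (H1 O) as [l Hl]. exists l. intros x Hx. apply Hl. lia.
    - destruct (H1 (S i)) as [l' Hl']. exists (l' ++ l). intros x Hx. apply in_app_iff.
      destruct (Nat.eq_dec (c x) (S i)); [auto|]. right. apply Hl. lia. }
  exists (fun i p => (c (fst p) <= i)%nat /\ (c (snd p) <= i)%nat). split; [|split].
  - intros i. destruct (Hfin i) as [l Hl]. exists (list_prod l l). intros [x y] [Hx Hy].
    apply in_prod; auto.
  - intros; lia.
  - intros p. exists (max (c (fst p)) (c (snd p))). lia.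
Qed.

Lemma qmin_nonneg (V : Type) (q : V -> V -> R) qmin : is_qmin q qmin -> 0 <= qmin.
Proof. intros [_ H]. apply H. intros r (x & y & Hxy & ->). lra. Qed.

Unset Implicit Arguments.

Theorem mainTheorem8 (V : Type) (q : V -> V -> R) (qmin : R)
  (qt : V * V -> V * V -> R)
  (HV : countable_type V) (Hg : is_graph q) (Hrev : reversible q)
  (Hconn : connected q) (Hcurv : nonneg_ollivier q)
  (Hqmin : is_qmin q qmin)
  (Hperf : perfect_coupling q qmin qt) :
  forall (t : R) (x y : V), 0 < t ->
    heat qt t (indic (@offdiag V)) (x, y) <= phi qmin t (gdist q x y) /\
    2 * sqrt (t * qmin) * phi qmin t (gdist q x y) <= INR (gdist q x y).
Proof.
  intros t x y Ht. pose proof (qmin_nonneg Hqmin) as H0. split.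
  - destruct (countable_square_exhaustion HV) as [A HA].
    apply (@heat_le _ qt (proj1 (proj1 Hperf))) with (A := A); auto; try lra.
    + intros; apply indic_bounds.
    + intros i. apply PS_offdiag_le; auto; try lra. apply HA.
  - apply phi_sqrt_le; lra.
Qed.
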